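(* Let $\mathbf{k}$ be a field of characteristic $0$, $V$ a finite-dimensional $\mathbf{k}$-vector space, and $X \subseteq V$ a conical subscheme. For every positive integer $r$ there is an integer $C_X(r)$, depending on $r$ and $X$ but independent of $d$, such that for every $d \ge 1$ the ideal of $\mathrm{Sec}_{d,r}(X)$ is generated by polynomials of degree $\le C_X(r)$.
   Context: A subscheme $X \subseteq V$ is conical if its defining ideal $I_X \subseteq \mathrm{Sym}(V^* )$ is homogeneous. Put $B = \mathrm{Sym}(V^* )/I_X = \bigoplus_{e\ge 0} B_e$. For a vector space $W$ and ideals $I,J \subseteq \mathrm{Sym}(W)$, the join $I \star J$ is the kernel of the composite $\mathrm{Sym}(W) \xrightarrow{\Delta} \mathrm{Sym}(W)\otimes\mathrm{Sym}(W) \to \mathrm{Sym}(W)/I \otimes \mathrm{Sym}(W)/J$, where $\Delta$ is the standard comultiplication (the algebra homomorphism with $\Delta(w) = w\otimes 1 + 1 \otimes w$ for $w \in W$); set $I^{\star 1}=I$ and $I^{\star r} = I \star I^{\star(r-1)}$. The ideal of the $d$th Veronese embedding of $X$ is the kernel $J_d \subseteq \mathrm{Sym}(B_d)$ of the surjection $\mathrm{Sym}(B_d) \to \bigoplus_{e \ge 0} B_{de}$ induced by multiplication in $B$, and $\mathrm{Sec}_{d,r}(X)$ is the subscheme of $B_d^*$ defined by the ideal $J_d^{\star r} \subseteq \mathrm{Sym}(B_d)$; this ideal is what ''the ideal of $\mathrm{Sec}_{d,r}(X)$'' refers to. *)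

(* Defs.v *)
From HB Require Import structures.
From mathcomp Require Import all_boot all_order all_algebra.
From mathcomp Require Import mpoly.
Set Implicit Arguments. Unset Strict Implicit. Unset Printing Implicit Defensive.
Import GRing.Theory.
Local Open Scope ring_scope.

(* Sym(W) for dim W = n is modelled as {mpoly F[n]} (choice of a basis).
   Ideals are represented as predicates (Prop-valued) on polynomial rings. *)

Definition is_ideal (F : fieldType) (n : nat) (I : {mpoly F[n]} -> Prop) : Prop :=
  [/\ I 0, (forall p q, I p -> I q -> I (p + q)) & (forall a p, I p -> I (a * p))].

Definition hcomp (F : fieldType) (n : nat) (e : nat) (p : {mpoly F[n]}) : {mpoly F[n]} :=
  \sum_(m <- msupp p | mdeg m == e) p@_m *: 'X_[m].

Definition is_homog_ideal (F : fieldType) (n : nat) (I : {mpoly F[n]} -> Prop) : Prop :=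
  is_ideal I /\ (forall p e, I p -> I (hcomp e p)).

Definition homog_of_deg (F : fieldType) (n : nat) (d : nat) (p : {mpoly F[n]}) : bool :=
  all (fun m => mdeg m == d) (msupp p).

Definition ideal_gen (F : fieldType) (n : nat) (S : {mpoly F[n]} -> Prop)
    (p : {mpoly F[n]}) : Prop :=
  exists s : seq ({mpoly F[n]} * {mpoly F[n]}),
    (forall x, x \in s -> S x.2) /\ p = \sum_(x <- s) x.1 * x.2.

(* images of the first / second tensor factor and the comultiplication
   Sym(W) -> Sym(W) (x) Sym(W) = {mpoly F[m + m]} *)
Definition yvars (F : fieldType) (m : nat) : m.-tuple {mpoly F[m + m]} :=
  [tuple 'X_(lshift m i) | i < m].
Definition zvars (F : fieldType) (m : nat) : m.-tuple {mpoly F[m + m]} :=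
  [tuple 'X_(rshift m i) | i < m].
Definition comult (F : fieldType) (m : nat) : m.-tuple {mpoly F[m + m]} :=
  [tuple 'X_(lshift m i) + 'X_(rshift m i) | i < m].

(* join I * J = kernel of Sym W -> Sym W (x) Sym W -> Sym W / I (x) Sym W / J;
   the kernel of the second map is the ideal generated by I (x) 1 and 1 (x) J *)
Definition join (F : fieldType) (m : nat) (I J : {mpoly F[m]} -> Prop)
    (p : {mpoly F[m]}) : Prop :=
  ideal_gen (fun q => (exists a, I a /\ q = a \mPo yvars F m) \/
                      (exists b, J b /\ q = b \mPo zvars F m))
            (p \mPo comult F m).

(* starpow I k = I^{* (k+1)} *)
Fixpoint starpow (F : fieldType) (m : nat) (I : {mpoly F[m]} -> Prop) (k : nat)
    : {mpoly F[m]} -> Prop :=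
  match k with
  | 0 => I
  | k'.+1 => join I (starpow I k')
  end.

(* f is a tuple of representatives of a basis of B_d = (F[x]/I)_d *)
Definition basis_of_Bd (F : fieldType) (n : nat) (I : {mpoly F[n]} -> Prop)
    (d m : nat) (f : m.-tuple {mpoly F[n]}) : Prop :=
  [/\ (forall i, homog_of_deg d (tnth f i)),
      (forall c : 'I_m -> F, I (\sum_(i < m) c i *: tnth f i) -> forall i, c i = 0) &
      (forall p : {mpoly F[n]}, homog_of_deg d p ->
         exists c : 'I_m -> F, I (p - \sum_(i < m) c i *: tnth f i))].

(* J_d = kernel of Sym(B_d) -> B, y_i |-> class of f_i *)
Definition veronese_ideal (F : fieldType) (n : nat) (I : {mpoly F[n]} -> Prop)
    (m : nat) (f : m.-tuple {mpoly F[n]}) (p : {mpoly F[m]}) : Prop :=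
  I (p \mPo f).

Definition generated_in_deg_le (F : fieldType) (m : nat) (J : {mpoly F[m]} -> Prop)
    (C : nat) : Prop :=
  forall p, J p <-> ideal_gen (fun q => J q /\ (msize q <= C.+1)%N) p.

(* Main.v *)
(** In coordinates, J_d^{*r} is the kernel of the map
    [Sym(B_d) -> F[x^1, ..., x^r] / (I(x^1) + ... + I(x^r))] sending the basis
    vector [y_i] to [f_i(x^1) + ... + f_i(x^r)] ([starpow_usum],
    [starpow_point_sum]).  In characteristic 0 a form of degree [k] on [B_d] is
    the same as a symmetric tensor in [S_d^{(x) k}], where [S = F[x]], and it
    lies in J_d^{*r} iff every substitution of the points [x^1, ..., x^r] for
    its [k] tensor factors lands in the ideal above ([vanish]).  This condition
    is stable under multiplication by arbitrary tensors, so it relates different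
    [d], and under insertion of tensor factors.  Leading monomials of such
    tensors are words of length [k] over the monomials of [S], and Higman's
    lemma bounds the length of those which do not come from a shorter one; this
    bound is independent of [d], and a Groebner-style reduction shows that it
    bounds the degrees of the generators. *)

Require Import Defs.
From HB Require Import structures.
From mathcomp Require Import all_boot all_order all_algebra all_fingroup.
From mathcomp Require Import mpoly.
From Stdlib Require Import Classical ClassicalEpsilon.
Set Implicit Arguments. Unset Strict Implicit. Unset Printing Implicit Defensive.
Import Order.TTheory GRing.Theory.

(** * Well-quasi-orders and Higman's lemma *)

Section WellQuasiOrders.

Variable A : Type.
Implicit Type R : A -> A -> Prop.

Definition good_seq R (s : nat -> A) := exists i j, i < j /\ R (s i) (s j).

Definition increasing (g : nat -> nat) := forall i j, i < j -> g i < g j.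

Definition monotone_subseq R (s : nat -> A) :=
  exists g, increasing g /\ forall i j, i < j -> R (s (g i)) (s (g j)).

Lemma increasingS (g : nat -> nat) :
  (forall i, g i < g i.+1) -> increasing g.
Proof.
move=> gS i j; elim: j => // j IH; rewrite ltnS leq_eqVlt => /orP[/eqP->//|ij].
exact: ltn_trans (IH ij) (gS j).
Qed.

(* Indices without a larger successor are bounded: otherwise they would form
   a bad subsequence.  Beyond the bound a chain can be picked greedily. *)
Lemma good_monotone_subseq R (s : nat -> A) :
  (forall x y z, R x y -> R y z -> R x z) ->
  (forall s', good_seq R s') -> monotone_subseq R s.
Proof.
move=> Rtr good.
have [N HN] : exists N, forall i, N <= i -> exists j, i < j /\ R (s i) (s j).
  apply: NNPP => noN.
  have nxt N : {i | N <= i /\ forall j, i < j -> ~ R (s i) (s j)}.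
    apply: constructive_indefinite_description; apply: NNPP => H.
    apply: noN; exists N => i Ni; apply: NNPP => Hi; apply: H; exists i.
    by split=> // j ij Rij; apply: Hi; exists j.
  pose h := fix h i := if i is i'.+1 then sval (nxt (h i').+1) else sval (nxt 0).
  have hi : increasing h.
    by apply: increasingS => i; apply: (proj1 (svalP (nxt (h i).+1))).
  have [i [j [ij Rij]]] := good (s \o h).
  have Hh k : forall j, h k < j -> ~ R (s (h k)) (s j).
    by case: k => [|k]; apply: (proj2 (svalP (nxt _))).
  exact: (Hh i _ (hi _ _ ij) Rij).
have nxt i : {j | N <= i -> i < j /\ R (s i) (s j)}.
  apply: constructive_indefinite_description.
  case: (boolP (N <= i)) => [/HN[j Hj]|nNi]; first by exists j.
  by exists 0.
pose h := fix h i := if i is i'.+1 then sval (nxt (h i')) else N.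
have hN i : N <= h i.
  elim: i => //= i IH; case: (nxt _) => j /= /(_ IH)[ij _].
  exact: leq_trans IH (ltnW ij).
have hS i : h i < h i.+1 /\ R (s (h i)) (s (h i.+1)).
  exact: (svalP (nxt (h i)) (hN i)).
exists h; split; first by apply: increasingS => i; case: (hS i).
move=> i j; elim: j => // j IH; rewrite ltnS leq_eqVlt => /orP[/eqP->|ij].
  by case: (hS j).
exact: Rtr (IH ij) (proj2 (hS j)).
Qed.

End WellQuasiOrders.

Section Higman.

Variables (A : Type) (le : A -> A -> Prop) (emb : seq A -> seq A -> Prop).
Hypothesis le_mono : forall s, monotone_subseq le s.
Hypothesis emb0 : forall w, emb [::] w.
Hypothesis emb_skip : forall u a w, emb u w -> emb u (a :: w).
Hypothesis emb_cons :
  forall a b u w, le a b -> emb u w -> emb (a :: u) (b :: w).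

Local Notation bad s := (~ good_seq emb s).

Definition agree_below (k : nat) (s t : nat -> seq A) :=
  forall i, i < k -> s i = t i.

(** Induction on a bound [m] for the length of entry [k]: either some bad extension does better, or
    the current one is shortest. *)
Lemma minimal_bad_extension (k : nat) (s : nat -> seq A) : bad s ->
  exists t, [/\ bad t, agree_below k s t &
    forall t', bad t' -> agree_below k s t' -> size (t k) <= size (t' k)].
Proof.
move=> bs.
have [m] : exists m, exists t, [/\ bad t, agree_below k s t & size (t k) <= m].
  by exists (size (s k)), s.
elim: m => [|m IH] [t [bt st tm]].
  by exists t; split=> // t' _ _; rewrite (leq_trans tm).
have [|noH] := classic
  (exists t, [/\ bad t, agree_below k s t & size (t k) <= m]); first exact: IH.
exists t; split=> // t' bt' st'; apply: leq_trans tm _; rewrite ltnNge.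
by apply/negP => Ht'; apply: noH; exists t'.
Qed.

(* Nash-Williams' minimal bad sequence argument. *)
Lemma higman (s : nat -> seq A) : good_seq emb s.
Proof.
apply: NNPP => bs.
have stepP k (u : nat -> seq A) : {t | bad u -> [/\ bad t, agree_below k u t &
    forall t', bad t' -> agree_below k u t' -> size (t k) <= size (t' k)]}.
  apply: constructive_indefinite_description.
  have [/(minimal_bad_extension k)[t Ht]|gu] := classic (bad u); first by exists t.
  by exists u.
(* [S k.+1] keeps the first [k] entries of [S k] and minimizes entry [k]; the diagonal [t] is a bad
   sequence minimal at every index. *)
pose S := fix S k := if k is k'.+1 then sval (stepP k' (S k')) else s.
have bS k : bad (S k).
  by elim: k => //= k IH; case: (stepP _ _) => t /= /(_ IH)[].
have SP k := svalP (stepP k (S k)) (bS k).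
pose t i := S i.+1 i.
have St k i : i < k -> S k i = t i.
  elim: k => // k IH; rewrite ltnS leq_eqVlt => /orP[/eqP->//|ik].
  by rewrite -(IH ik); case: (SP k) => _ /(_ i ik) ->.
have bt : bad t.
  case=> i [j [ij e]]; apply: (bS j.+1); exists i, j; split=> //.
  by rewrite !St // ltnW.
have tmin k t' : bad t' -> agree_below k t t' -> size (t k) <= size (t' k).
  move=> bt' tt'; case: (SP k) => _ _; apply=> // i ik.
  by rewrite St ?tt'.
have tcons i : exists a, exists u, t i = a :: u.
  case E: (t i) => [|a u]; last by exists a, u.
  by case: bt; exists i, i.+1; rewrite E.
have [a Ha] := choice _ tcons.
have [u Hu] := choice _ Ha.
have [g [gi ga]] := le_mono a.
(* The heads are dropped along a subsequence with increasing first letters. A good pair of [t']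
   would lift to one of [t], yet [t'] is shorter at [g 0]. *)
pose t' i := if i < g 0 then t i else u (g (i - g 0)).
suff bt' : bad t'.
  have := tmin (g 0) t' bt'; rewrite /t' ltnn subnn Hu /= ltnn.
  by case/(_ _)/implyP => // i ->.
case=> i [j [ij]]; rewrite /t'; case: ifP => [ig|/negbT ig].
  case: ifP => [jg|/negbT jg] e; first by apply: bt; exists i, j.
  apply: bt; exists i, (g (j - g 0)); split; last by rewrite (Hu (g _)); apply: emb_skip.
  apply: leq_trans ig _; case: (j - g 0) => // m; exact/ltnW/gi.
rewrite -leqNgt in ig; rewrite ltnNge (leq_trans ig (ltnW ij)) /= => e.
have lt_ij : i - g 0 < j - g 0 by rewrite ltn_sub2r // (leq_ltn_trans ig).
apply: bt; exists (g (i - g 0)), (g (j - g 0)); split; first exact: gi.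
by rewrite Hu (Hu (g (j - _))); apply: emb_cons => //; apply: ga.
Qed.

End Higman.

Lemma leq_monotone_subseq (s : nat -> nat) :
  monotone_subseq (fun a b => a <= b) s.
Proof.
apply: good_monotone_subseq => [x y z|s']; first exact: leq_trans.
have [m] := ubnP (s' 0); elim: m s' => // m IH s' ms.
have [le01|] := leqP (s' 0) (s' 1); first by exists 0, 1.
rewrite ltnS in ms => /leq_trans/(_ ms)/(IH (s' \o S))[i [j [ij le]]].
by exists i.+1, j.+1.
Qed.

Local Open Scope ring_scope.

(** Dickson's lemma: the subsequence is refined for one coordinate at a time. *)
Lemma mnm_monotone_subseq n (s : nat -> 'X_{1..n}) :
  monotone_subseq (fun a b => (a <= b)%MM) s.
Proof.
suff /(_ n)[g [gi Hg]] : forall k, exists g, increasing g /\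
    forall i j, (i < j)%N -> forall l : 'I_n, (l < k)%N -> (s (g i) l <= s (g j) l)%N.
  by exists g; split=> // i j ij; apply/mnm_lepP => l; apply: Hg.
elim=> [|k [g [gi Hg]]]; first by exists id; split.
have [nk|kn] := leqP n k.
  by exists g; split=> // i j ij l _; rewrite Hg // (leq_trans (ltn_ord l)).
have [h [hi Hh]] := leq_monotone_subseq (fun i => s (g i) (Ordinal kn)).
exists (g \o h); split=> [i j /hi/gi //|i j ij l].
rewrite ltnS leq_eqVlt => /orP[/eqP lk|lk]; last exact: Hg (hi _ _ ij) _ lk.
by have -> : l = Ordinal kn by [apply: val_inj]; apply: Hh.
Qed.

(** * Words over the monomials and their lexicographic order *)

Section Words.

Import Order.DefaultSeqLexiOrder.

Variable n : nat.
Local Notation word := (seq 'X_{1..n}).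

Definition monos (d : nat) : word :=
  [seq m <- [seq val b | b <- enum {: 'X_{1..n < d.+1}}] | mdeg m == d].

Fixpoint words (k d : nat) : seq word :=
  if k is k'.+1 then [seq m :: w | m <- monos d, w <- words k' d] else [:: [::]].

Lemma mem_monos d m : (m \in monos d) = (mdeg m == d).
Proof.
rewrite mem_filter; case: eqP => //= md.
have lt_md : (mdeg m < d.+1)%N by rewrite md.
by apply/mapP; exists (BMultinom lt_md); rewrite ?mem_enum.
Qed.

Lemma monos_uniq d : uniq (monos d).
Proof. by rewrite filter_uniq // map_inj_uniq ?enum_uniq //; apply: val_inj. Qed.

Lemma mem_words k d w :
  (w \in words k d) = (size w == k) && all (fun m => mdeg m == d) w.
Proof.
elim: k w => [|k IH] [|m w] //=.
  by apply/allpairsP => -[[a b] /= []].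
apply/allpairsP/idP => [[[a b] /= [ad bw [-> ->]]]|].
  by move: bw; rewrite IH eqSS => /andP[-> ->]; rewrite -mem_monos ad.
rewrite eqSS => /and3P[sw md aw]; exists (m, w) => /=.
by rewrite mem_monos md IH sw aw.
Qed.

Lemma words_uniq k d : uniq (words k d).
Proof.
elim: k => //= k IH; apply: allpairs_uniq (monos_uniq d) IH _.
by move=> [a u] [b v] _ _ /= [-> ->].
Qed.

(** Choosing one monomial in each factor is choosing a word. The index of [c] is a natural number so
    that the induction can shift it. *)
Lemma big_words (R : pzRingType) k d (c : nat -> 'X_{1..n} -> R) :
  \sum_(w <- words k d) \prod_(l < k) c l (nth 0%MM w l)
  = \prod_(l < k) \sum_(m <- monos d) c l m.
Proof.
elim: k c => [|k IH] c /=.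
  by rewrite big_seq1 !big_ord0.
rewrite big_allpairs_dep big_ord_recl mulr_suml; apply: eq_bigr => m _.
rewrite -(IH (fun l => c l.+1)) mulr_sumr; apply: eq_bigr => w _.
by rewrite big_ord_recl.
Qed.

(** Words are read as pure tensors of monomials, and this is their product. *)
Definition wshift (g u : word) : word := [seq (x.1 + x.2)%MM | x <- zip g u].

Definition wle (u v : word) := all2 (fun a b : 'X_{1..n} => (a <= b)%MM) u v.

Definition wdiff (u v : word) : word := [seq (x.2 - x.1)%MM | x <- zip u v].

Lemma wshift_mono g u v : size u = size g -> size v = size g ->
  (u <= v)%O -> (wshift g u <= wshift g v)%O.
Proof.
elim: g u v => [|a g IH] [|b u] [|c v] //= [su] [sv].
rewrite /wshift /= !lexi_cons !lemc_add2r => /andP[-> /implyP H] /=.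
by apply/implyP => /H; apply: IH.
Qed.

Lemma wshift_inj g u v : size u = size g -> size v = size g ->
  wshift g u = wshift g v -> u = v.
Proof.
rewrite /wshift; elim: g u v => [|a g IH] [|b u] [|c v] //= [su] [sv] E.
have /eqP := congr1 (head 0%MM) E; rewrite /= eqm_add2l => /eqP ->.
by have /= /IH -> := congr1 behead E.
Qed.

Lemma wshift_diff u v : wle u v -> wshift (wdiff u v) u = v.
Proof.
rewrite /wshift /wdiff; elim: u v => [|a u IH] [|b v] //= /andP[ab uv].
by rewrite IH // submK.
Qed.

Lemma wle_size u v : wle u v -> size u = size v.
Proof. by rewrite /wle all2E => /andP[/eqP]. Qed.

Lemma size_wdiff u v : wle u v -> size (wdiff u v) = size u.
Proof. by move=> uv; rewrite size_map size1_zip // (wle_size uv). Qed.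

Lemma wshift_words k d e u v x : wle u v -> u \in words k d ->
  v \in words k e -> x \in words k d -> wshift (wdiff u v) x \in words k e.
Proof.
rewrite !mem_words => uv /andP[/eqP su au] /andP[/eqP sv av] /andP[/eqP sx ax].
rewrite size_map size2_zip ?size_wdiff ?su ?sx // eqxx /=.
elim: k u v x uv su au sv av sx ax => [|k IH] [|a u] [|b v] [|c x] //=.
rewrite /wle /= => /andP[ab uv] [su] /andP[/eqP ad au] [sv] /andP[/eqP be av].
move=> [sx] /andP[/eqP cd ax].
by rewrite mdegD cd -ad -mdegD submK // be eqxx; apply: (IH u).
Qed.

(* [winsert b w x] puts the letters of [x] at the positions of [w] selected by
   the mask [b]. *)
Fixpoint winsert (b : bitseq) (w x : word) : word :=
  match b, w, x with
  | true :: b', _ :: w', c :: x' => c :: winsert b' w' x'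
  | false :: b', m :: w', _ => m :: winsert b' w' x
  | _, _, _ => [::]
  end.

Lemma winsert_mask b w : size b = size w -> winsert b w (mask b w) = w.
Proof. by elim: b w => [|[] b IH] [|m w] //= [] /IH ->. Qed.

(** Two insertions into [w] agree off the mask, so their first difference is that of [u] and [v]. *)
Lemma winsert_mono b w u v : size b = size w -> size u = count id b ->
  size v = count id b -> (u <= v)%O -> (winsert b w u <= winsert b w v)%O.
Proof.
elim: b w u v => [|[] b IH] [|m w] u v //= [sb].
  case: u v => [|a u] [|c v] //= [su] [sv].
  rewrite !lexi_cons => /andP[-> /implyP H]; apply/implyP => /H; exact: IH.
by move=> su sv uv; rewrite lexi_cons lexx /= IH.
Qed.

Lemma winsert_inj b w x y : size b = size w -> size x = count id b ->
  size y = count id b -> winsert b w x = winsert b w y -> x = y.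
Proof.
elim: b w x y => [|[] b IH] [|m w] x y //=; first by case: x; case: y.
  case: x y => [|a x] [|c y] //= [sb] [sx] [sy] E.
  have /= -> := congr1 (head 0%MM) E; have /= H := congr1 behead E.
  by rewrite (IH _ _ _ sb sx sy H).
by move=> [sb] sx sy /(congr1 behead); apply: IH.
Qed.

Lemma big_winsert (R : comPzRingType) (l : 'X_{1..n} -> R) b w x :
  size b = size w -> size x = count id b ->
  \prod_(m <- winsert b w x) l m
  = (\prod_(m <- mask (map negb b) w) l m) * \prod_(m <- x) l m.
Proof.
elim: b w x => [|[] b IH] [|m w] x //=.
- by case: x => //; rewrite big_nil mulr1.
- by case: x => //= c x [sb] [sx]; rewrite !big_cons IH // mulrCA.
- by move=> [sb] sx; rewrite !big_cons IH // mulrA.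
Qed.

Lemma winsert_words k d b w x : size b = size w -> w \in words k d ->
  x \in words (count id b) d -> winsert b w x \in words k d.
Proof.
rewrite !mem_words => sb /andP[/eqP <- aw] /andP[/eqP sx ax].
elim: b w x sb aw sx ax => [|[] b IH] [|m w] x //= [sb] /andP[md aw].
  case: x => //= c x [sx] /andP[cd ax]; rewrite eqSS cd /=; exact: IH.
by move=> sx ax; rewrite eqSS md /=; apply: IH.
Qed.

Lemma mask_words k d b w : size b = k -> w \in words k d ->
  mask b w \in words (count id b) d.
Proof.
rewrite !mem_words => sb /andP[/eqP sw aw]; rewrite size_mask ?sb ?sw //= eqxx /=.
by apply/allP => m /mem_mask /(allP aw).
Qed.

Definition wemb (u w : word) :=
  exists b, size b = size w /\ wle u (mask b w).

Lemma higman_words (s : nat -> word) : good_seq wemb s.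
Proof.
apply: (higman (@mnm_monotone_subseq n)).
- by move=> w; exists (nseq (size w) false); rewrite size_nseq mask_false.
- by move=> u a w [b [sb H]]; exists (false :: b); rewrite /= sb.
- move=> a c u w ac [b [sb H]]; exists (true :: b); split; first by rewrite /= sb.
  by rewrite /wle /= ac.
Qed.

End Words.

(** * Vanishing tensors and their leading words *)

Section Ideals.

Variables (F : fieldType) (n : nat).
Implicit Types (J S : {mpoly F[n]} -> Prop) (p q : {mpoly F[n]}).

Lemma ideal_sum J (T : eqType) (s : seq T) (P : pred T) (h : T -> {mpoly F[n]}) :
  is_ideal J -> (forall x, x \in s -> P x -> J (h x)) -> J (\sum_(x <- s | P x) h x).
Proof.
move=> [J0 JD _] Jh; rewrite big_seq_cond.
by apply: (big_ind J) => // x /andP[]; apply: Jh.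
Qed.

Lemma idealZ J c p : is_ideal J -> J p -> J (c *: p).
Proof. by move=> [_ _ JM] Jp; rewrite -mul_mpolyC; apply: JM. Qed.

Lemma idealMr J p q : is_ideal J -> J p -> J (p * q).
Proof. by move=> [_ _ JM] Jp; rewrite mulrC; apply: JM. Qed.

Lemma idealN J p : is_ideal J -> J p -> J (- p).
Proof. by move=> iJ Jp; rewrite -scaleN1r; apply: idealZ. Qed.

Lemma idealB J p q : is_ideal J -> J p -> J q -> J (p - q).
Proof. by move=> iJ Jp Jq; case: (iJ) => _ JD _; apply: JD (idealN iJ Jq). Qed.

Lemma ideal_gen_ideal S : is_ideal (ideal_gen S).
Proof.
split=> [|p q [s [Ss ->]] [t [St ->]]|a p [s [Ss ->]]].
- by exists [::]; rewrite big_nil.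
- exists (s ++ t); rewrite big_cat; split=> // x.
  by rewrite mem_cat => /orP[/Ss|/St].
- exists [seq (a * x.1, x.2) | x <- s]; split.
    by move=> _ /mapP[x /Ss Sx ->].
  by rewrite big_map mulr_sumr; apply: eq_bigr => x _; rewrite mulrA.
Qed.

Lemma ideal_gen_mem S p : S p -> ideal_gen S p.
Proof.
move=> Sp; exists [:: (1, p)]; rewrite big_seq1 mul1r; split=> // x.
by rewrite inE => /eqP ->.
Qed.

Lemma ideal_gen_sub S J p :
  is_ideal J -> (forall q, S q -> J q) -> ideal_gen S p -> J p.
Proof.
move=> iJ SJ [s [Ss ->]]; apply: ideal_sum => // x xs _.
by case: iJ => _ _; apply; apply/SJ/Ss.
Qed.

Lemma ideal_comp m (t : m.-tuple {mpoly F[n]}) J :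
  is_ideal J -> is_ideal (fun p : {mpoly F[m]} => J (p \mPo t)).
Proof.
move=> [J0 JD JM]; split=> [|p q Jp Jq|a p Jp]; first by rewrite comp_mpoly0.
  by rewrite comp_mpolyD; apply: JD.
by rewrite rmorphM; apply: JM.
Qed.

End Ideals.

Section PointIdeals.

Import Order.DefaultSeqLexiOrder.

Variables (F : fieldType) (n M : nat) (aa : {mpoly F[M]} -> Prop).
Variable pts : seq (n.-tuple {mpoly F[M]}).
Hypothesis aa_ideal : is_ideal aa.
Local Notation word := (seq 'X_{1..n}).
Local Notation point := (n.-tuple {mpoly F[M]}).

Fixpoint weval (w : word) (vs : seq point) : {mpoly F[M]} :=
  match w, vs with
  | m :: w', v :: vs' => ('X_[m] \mPo v) * weval w' vs'
  | _, _ => 1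
  end.

(* [P : word -> F] stands for the tensor [\sum_w P w *: w] in the [k]-fold
   tensor power of the degree [d] forms; it belongs to [vanish k d] when every
   substitution of points of [pts] for its tensor factors lands in [aa]. *)
Definition vanish (k d : nat) (P : word -> F) := forall vs : seq point,
  size vs = k -> {subset vs <= pts} ->
  aa (\sum_(w <- words n k d) P w *: weval w vs).

(** Counterpart of initial monomials. The tensors need not be symmetric, so that multiplication by
    any pure tensor is allowed. *)
Definition lead_word (k d : nat) (w : word) := w \in words n k d /\
  exists P, [/\ vanish k d P, P w = 1 &
    forall u, u \in words n k d -> P u != 0 -> (u <= w)%O].

(** Linear extension of [T] from words to tensors. *)
Definition wpush (T : word -> word) (k d : nat) (P : word -> F) (v : word) : F :=
  \sum_(x <- words n k d) P x *+ (v == T x).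

Lemma wpush_sum (V : lmodType F) T k d k' d' P (h : word -> V) :
  (forall x, x \in words n k d -> T x \in words n k' d') ->
  \sum_(v <- words n k' d') wpush T k d P v *: h v
  = \sum_(x <- words n k d) P x *: h (T x).
Proof.
move=> HT; rewrite /wpush.
under eq_bigr do rewrite scaler_suml.
rewrite exchange_big big_seq [RHS]big_seq /=; apply: eq_bigr => x xk.
rewrite (bigD1_seq (T x)) ?words_uniq ?HT //= eqxx big1 ?addr0 // => v /negbTE ->.
by rewrite scale0r.
Qed.

Lemma wpush_lead T k d P u : u \in words n k d -> {in words n k d &, injective T} ->
  wpush T k d P (T u) = P u.
Proof.
move=> uk Tinj; rewrite /wpush (bigD1_seq u) ?words_uniq //= eqxx big1_seq ?addr0 //.
move=> x /andP[xu xk]; case: eqP => // /(Tinj u x uk xk) E.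
by rewrite E eqxx in xu.
Qed.

Lemma wpush_supp T k d P v : wpush T k d P v != 0 ->
  exists x, [/\ x \in words n k d, P x != 0 & v = T x].
Proof.
move=> H; apply: NNPP => noH; case/negP: H; apply/eqP.
rewrite /wpush big1_seq // => x /andP[_ xk].
have [->|Px] := eqVneq (P x) 0; first by rewrite mul0rn.
by case: eqP => // vT; case: noH; exists x.
Qed.

Lemma weval_wshift g u vs : size g = size u -> size vs = size u ->
  weval (wshift g u) vs = weval g vs * weval u vs.
Proof.
elim: u g vs => [|a u IH] [|b g] [|v vs] //=; rewrite ?mulr1 //.
move=> [sg] [sv]; rewrite /wshift /= -/(wshift g u) IH // mpolyXD rmorphM.
by rewrite mulrACA.
Qed.

Lemma weval_winsert b w x vs : size b = size w -> size vs = size w ->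
  size x = count id b ->
  weval (winsert b w x) vs
  = weval (mask (map negb b) w) (mask (map negb b) vs) * weval x (mask b vs).
Proof.
elim: b w x vs => [|[] b IH] [|m w] x [|v vs] //=.
- by case: x => //; rewrite mulr1.
- case: x => //= c x [sb] [sv] [sx]; rewrite IH // mulrCA //.
- by move=> [sb] [sv] sx; rewrite IH // mulrA.
Qed.

(** The common factor [h vs] is absorbed by the ideal. This covers multiplication by a pure tensor
    ([sel] the identity) and insertion of letters ([sel] a mask). *)
Lemma vanish_wpush T (sel : seq point -> seq point) (h : seq point -> {mpoly F[M]})
    k d k' d' P :
  (forall x, x \in words n k d -> T x \in words n k' d') ->
  (forall vs, size vs = k' -> size (sel vs) = k /\ {subset sel vs <= vs}) ->
  (forall vs x, size vs = k' -> x \in words n k d ->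
     weval (T x) vs = h vs * weval x (sel vs)) ->
  vanish k d P -> vanish k' d' (wpush T k d P).
Proof.
move=> HT Hsel Hh vP vs svs vpts; rewrite wpush_sum //.
have [ss sv] := Hsel vs svs.
rewrite (eq_big_seq (fun x => h vs * (P x *: weval x (sel vs)))); last first.
  by move=> x xk; rewrite Hh // scalerAr.
rewrite -mulr_sumr; case: aa_ideal => _ _; apply; apply: vP => // v /sv.
exact: vpts.
Qed.

Lemma lead_word_wpush T k d u P :
  {in words n k d &, injective T} ->
  {in words n k d &, forall x y, (x <= y)%O -> (T x <= T y)%O} ->
  u \in words n k d -> P u = 1 ->
  (forall x, x \in words n k d -> P x != 0 -> (x <= u)%O) ->
  wpush T k d P (T u) = 1 /\
  (forall v, wpush T k d P v != 0 -> (v <= T u)%O).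
Proof.
move=> Tinj Tmono uk Pu Pmax; split; first by rewrite wpush_lead.
by move=> v /wpush_supp[x [xk Px ->]]; apply: Tmono => //; apply: Pmax.
Qed.

(** Multiplication by the pure tensor [wdiff u v] carries the leading word [u] to [v] and the degree
    [d] to [e]. *)
Lemma lead_word_up k d e u v : lead_word k d u -> v \in words n k e ->
  wle u v -> lead_word k e v.
Proof.
move=> [uk [P [vP Pu Pmax]]] vk uv; split=> //.
have su : size u = k by move: uk; rewrite mem_words => /andP[/eqP].
have sz x : x \in words n k d -> size x = size (wdiff u v).
  by rewrite mem_words size_wdiff // su => /andP[/eqP].
set T := wshift (wdiff u v).
have HT x : x \in words n k d -> T x \in words n k e by apply: wshift_words uv uk vk.
have mono : {in words n k d &, forall x y, (x <= y)%O -> (T x <= T y)%O}.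
  by move=> x y xk yk; apply: wshift_mono; apply: sz.
have inj : {in words n k d &, injective T}.
  by move=> x y /sz sx /sz sy; apply: wshift_inj.
have [Hv Hmax] := lead_word_wpush inj mono uk Pu Pmax.
have Tu : T u = v by apply: wshift_diff.
rewrite Tu in Hv Hmax.
exists (wpush T k d P); split=> // [|x _ /Hmax //].
apply: (@vanish_wpush _ id (weval (wdiff u v))) vP => // [vs svs|vs x svs xk]; first by split.
by rewrite /T weval_wshift ?(sz x) // size_wdiff // su.
Qed.

Definition reducible (d : nat) (w : word) := exists b,
  [/\ size b = size w, (count id b < size w)%N &
      lead_word (count id b) d (mask b w)].

(** Otherwise there are irreducible leading words of ever larger length, in varying degrees [d].
    Higman's lemma embeds one into a longer one, whose selected subword is then a leading word by
    [lead_word_up]. *)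
Lemma lead_words_reducible : exists C, forall k d w,
  (C < k)%N -> lead_word k d w -> reducible d w.
Proof.
apply: NNPP => noC.
have irr C : exists dw : nat * word, [/\ (C < size dw.2)%N,
    lead_word (size dw.2) dw.1 dw.2 & ~ reducible dw.1 dw.2].
  apply: NNPP => H; apply: noC; exists C => k d w Ck lw; apply: NNPP => nr.
  have sw : size w = k by case: lw; rewrite mem_words => /andP[/eqP].
  by apply: H; exists (d, w); rewrite /= sw; split.
have [g Hg] := choice _ irr.
(* Each word is chosen longer than the previous one; [h i.+1] is the length of the [i]-th. *)
pose h := fix h i := if i is i'.+1 then size (g (h i')).2 else 0%N.
have hi : increasing h.
  by apply: increasingS => i /=; case: (Hg (h i)).
have [i [j [ij [b [sb le]]]]] := higman_words (fun i => (g (h i)).2).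
have [Hj lj nr] := Hg (h j); apply: nr; exists b; split=> //.
  rewrite -(size_mask sb) -(wle_size le) -[X in (X < _)%N]/(h i.+1).
  apply: leq_ltn_trans Hj.
  by have := ij; rewrite leq_eqVlt => /orP[/eqP ->|/hi/ltnW].
have [_ li _] := Hg (h i).
have Ec : count id b = size (g (h i)).2 by rewrite -(size_mask sb) (wle_size le).
rewrite Ec; apply: lead_word_up li _ le; rewrite -Ec.
exact: mask_words sb (proj1 lj).
Qed.

(* Each reduction step subtracts a multiple of a tensor obtained by inserting
   letters into a shorter vanishing one, and [\prod_(m <- w) l m] turns the
   inserted letters into a factor. *)
Lemma vanish_short_ind N (G : {mpoly F[N]} -> Prop) (l : 'X_{1..n} -> {mpoly F[N]}) d C :
  is_ideal G ->
  (forall k w, (C < k)%N -> lead_word k d w -> reducible d w) ->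
  (forall k P, (k <= C)%N -> vanish k d P ->
     G (\sum_(w <- words n k d) P w *: \prod_(m <- w) l m)) ->
  forall k P, vanish k d P -> G (\sum_(w <- words n k d) P w *: \prod_(m <- w) l m).
Proof.
move=> iG HC Hshort k; have [K] := ubnP k; elim: K k => // K IHK k kK P vP.
have [|Ck] := leqP k C; first by move=> kC; apply: Hshort.
pose ge (u v : word) := (v <= u)%O.
pose W := sort ge (words n k d).
have memW u : (u \in W) = (u \in words n k d) by rewrite mem_sort.
have sortW : sorted ge W by apply: sort_sorted => u v; apply: le_total.
have getr : transitive ge by move=> a b c /= ba cb; apply: le_trans cb ba.
(* Words are treated from the largest down: the coefficients on [t] are already zero, and [s]
   remains. *)
suff: forall s t, t ++ s = W -> forall P, vanish k d P -> {in t, forall u, P u = 0} ->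
    G (\sum_(w <- words n k d) P w *: \prod_(m <- w) l m).
  by move/(_ W [::] erefl P vP); apply.
move=> {P vP}; elim=> [|w s IH] t tW P vP Pt.
  rewrite big1_seq; first by case: iG.
  by move=> u /andP[_]; rewrite -memW -tW cats0 => /Pt ->; rewrite scale0r.
have [Pw0|Pw] := eqVneq (P w) 0.
  apply: (IH (rcons t w)) => //; first by rewrite cat_rcons.
  by move=> u; rewrite mem_rcons inE => /orP[/eqP ->|/Pt].
have wk : w \in words n k d by rewrite -memW -tW mem_cat mem_head orbT.
have geP u : u \in words n k d -> P u != 0 -> (u <= w)%O.
  rewrite -memW -tW mem_cat => /orP[/Pt ->|]; first by rewrite eqxx.
  rewrite inE => /orP[/eqP -> //|us] _.
  move: sortW; rewrite -tW => /(subseq_sorted getr (suffix_subseq t (w :: s))).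
  by rewrite /= path_sortedE // => /andP[/allP/(_ u us)].
have lw : lead_word k d w.
  split=> //; exists (fun u => (P w)^-1 * P u); split.
  - move=> vs svs vpts.
    under eq_bigr do rewrite -scalerA.
    by rewrite -scaler_sumr; apply: idealZ => //; apply: vP.
  - by rewrite mulVf.
  - move=> u uk; rewrite mulf_eq0 negb_or => /andP[_]; exact: geP.
have [b [sb cb [uk [Q [vQ Qu Qmax]]]]] := HC k w Ck lw.
have sw : size w = k by move: wk; rewrite mem_words => /andP[/eqP].
rewrite sw in cb.
set T := winsert b w; set k' := count id b in uk vQ Qmax cb.
have sz x : x \in words n k' d -> size x = k' by rewrite mem_words => /andP[/eqP].
have HT x : x \in words n k' d -> T x \in words n k d by apply: winsert_words.
have mono : {in words n k' d &, forall x y, (x <= y)%O -> (T x <= T y)%O}.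
  by move=> x y /sz sx /sz sy; apply: winsert_mono.
have inj : {in words n k' d &, injective T}.
  by move=> x y /sz sx /sz sy; apply: winsert_inj.
have Tw : T (mask b w) = w by apply: winsert_mask.
have [] := lead_word_wpush inj mono uk Qu Qmax.
rewrite Tw => Rw Rmax; set R := wpush T k' d Q in Rw Rmax.
have vR : vanish k d R.
  apply: (@vanish_wpush T (mask b)
    (fun vs => weval (mask (map negb b) w) (mask (map negb b) vs))) vQ => //.
  - move=> vs svs; split; first by rewrite size_mask // sb sw.
    by move=> v /mem_mask.
  - by move=> vs x svs /sz sx; rewrite /T weval_winsert // sw.
(* The inserted letters factor out of every term, and the shorter tensor [Q] is covered by the outer
   induction. *)
have GR : G (\sum_(v <- words n k d) R v *: \prod_(m <- v) l m).
  rewrite wpush_sum //.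
  rewrite (eq_big_seq (fun x => (\prod_(m <- mask (map negb b) w) l m)
      * (Q x *: \prod_(m <- x) l m))); last first.
    by move=> x /sz sx; rewrite -scalerAr /T big_winsert.
  rewrite -mulr_sumr; case: (iG) => _ _; apply; apply: IHK => //.
  exact: leq_trans cb _.
(* This cancels the coefficient of [w]. As [R] has leading word [w], the zeros on the larger words
   in [t] survive. *)
pose P' u := P u - P w * R u.
have vP' : vanish k d P'.
  move=> vs svs vpts; rewrite /P'.
  under eq_bigr do rewrite scalerBl -scalerA.
  rewrite big_split /= sumrN -scaler_sumr; apply: idealB => //; first exact: vP.
  by apply: idealZ => //; apply: vR.
have GP' : G (\sum_(w <- words n k d) P' w *: \prod_(m <- w) l m).
  apply: (IH (rcons t w)) => //; first by rewrite cat_rcons.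
  have Wu : uniq (t ++ w :: s) by rewrite tW sort_uniq words_uniq.
  move=> u; rewrite mem_rcons inE /P' => /orP[/eqP ->|ut].
    by rewrite Rw mulr1 subrr.
  rewrite Pt // sub0r; apply/eqP; rewrite oppr_eq0 mulf_eq0 (negbTE Pw) /=.
  case: eqP => // /eqP /(Rmax u) uw; exfalso.
  move: sortW; rewrite -tW => sW.
  have: ge u w.
    move: sW; rewrite sorted_pairwise // pairwise_cat => /andP[/allrelP/(_ u w ut)].
    by rewrite mem_head => /(_ isT).
  rewrite /ge => wu; have E : u = w by apply: le_anti; rewrite uw wu.
  by move: Wu; rewrite cat_uniq => /and3P[_ /hasPn/(_ w (mem_head _ _))]; rewrite -E ut.
have -> : \sum_(w <- words n k d) P w *: \prod_(m <- w) l m =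
   \sum_(w <- words n k d) P' w *: \prod_(m <- w) l m
   + P w *: \sum_(w <- words n k d) R w *: \prod_(m <- w) l m.
  rewrite scaler_sumr -big_split; apply: eq_bigr => u _.
  by rewrite /P' /= scalerA -scalerDl subrK.
by case: (iG) => _ GD _; apply: GD => //; apply: idealZ.
Qed.

End PointIdeals.

(** * Tensor products of quotients *)

Lemma comp_mpolyA (R : comNzRingType) (a b c : nat) (p : {mpoly R[a]})
    (s : a.-tuple {mpoly R[b]}) (t : b.-tuple {mpoly R[c]}) :
  (p \mPo s) \mPo t = p \mPo [tuple tnth s i \mPo t | i < a].
Proof.
rewrite (comp_mpolyEX p s) [RHS]comp_mpolyEX raddf_sum; apply: eq_bigr => m _ /=.
rewrite comp_mpolyZ !comp_mpolyX rmorph_prod /=; congr (_ *: _); apply: eq_bigr => i _.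
by rewrite rmorphXn tnth_mktuple.
Qed.

Lemma eq_comp_mpoly (R : comNzRingType) (a b : nat) (p : {mpoly R[a]})
    (s t : a.-tuple {mpoly R[b]}) :
  (forall i, tnth s i = tnth t i) -> p \mPo s = p \mPo t.
Proof. by move=> /eq_from_tnth ->. Qed.

Section SeparatingFunctional.

Variables (F : fieldType) (n N T : nat).
Variables (A : 'I_N -> {mpoly F[n]}) (u : 'I_T -> {mpoly F[n]}) (i0 : 'I_N).

(** The row vector selecting [i0] annihilates every linear relation between the coefficient columns
    of the [A i] and [u j], so it lies in the row space. *)
Lemma separating_functional :
  (forall c e, \sum_i c i *: A i + \sum_j e j *: u j = 0 -> c i0 = 0) ->
  exists (D : finType) (mon : D -> 'X_{1..n}) (la : D -> F),
    (forall i, \sum_x la x * (A i)@_(mon x) = (i == i0)%:R) /\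
    (forall j, \sum_x la x * (u j)@_(mon x) = 0).
Proof.
move=> indep.
(* All polynomials involved have degree less than [B], so finitely many coefficients determine
   them. *)
pose B := maxn (\max_i msize (A i)) (\max_j msize (u j)).
have [D [mon Hmon]] : exists (D : finType) (mon : D -> 'X_{1..n}),
    forall m, (mdeg m < B)%N -> exists x, mon x = m.
  exists 'X_{1..n < B}, val => m mB; by exists (BMultinom mB).
pose mx (x : 'I_#|D|) := mon (enum_val x).
pose MA : 'M[F]_(#|D|, N) := \matrix_(x, i) (A i)@_(mx x).
pose Mu : 'M[F]_(#|D|, T) := \matrix_(x, j) (u j)@_(mx x).
have sub : (row_mx (delta_mx 0 i0 : 'M_(1, N)) (0 : 'M_(1, T)) <= row_mx MA Mu)%MS.
  rewrite submxE; apply/eqP/matrixP => z k; rewrite ord1 [RHS]mxE.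
  have := mulmx_coker (row_mx MA Mu); move: (cokermx _) => K KE.
  rewrite mxE big_split_ord /= [X in _ + X]big1 ?addr0; last first.
    by move=> j _; rewrite row_mxEr mxE mul0r.
  rewrite (bigD1 i0) //= row_mxEl mxE !eqxx mul1r big1 ?addr0; last first.
    by move=> i /negbTE ii; rewrite row_mxEl mxE ii andbF mul0r.
  apply: (indep (fun i => K (lshift T i) k) (fun j => K (rshift N j) k)).
  apply/mpolyP => m; rewrite mcoeff0 mcoeffD !raddf_sum /=.
  have [mB|Bm] := ltnP (mdeg m) B; last first.
    rewrite !big1 ?addr0 // => [j|i] _; rewrite mcoeffZ memN_msupp_eq0 ?mulr0 //;
      apply: msize_mdeg_ge; apply: leq_trans Bm; rewrite leq_max; apply/orP.
    - by right; apply: (@leq_bigmax _ (fun j => msize (u j))).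
    - by left; apply: (@leq_bigmax _ (fun i => msize (A i))).
  have [x mx_m] := Hmon m mB.
  have := congr1 (fun Z : 'M_(_, _) => Z (enum_rank x) k) KE.
  rewrite [RHS]mxE mxE big_split_ord /= => H; rewrite -[RHS]H; congr (_ + _).
    by apply: eq_bigr => i _; rewrite row_mxEl mxE mcoeffZ mulrC /mx enum_rankK mx_m.
  by apply: eq_bigr => i _; rewrite row_mxEr mxE mcoeffZ mulrC /mx enum_rankK mx_m.
have /submxP[la laE] := sub.
have laP (p : 'I_N + 'I_T) :
    \sum_(x : D) la 0 (enum_rank x) * row_mx MA Mu (enum_rank x) (unsplit p)
    = row_mx (delta_mx 0 i0 : 'M_(1, N)) (0 : 'M_(1, T)) 0 (unsplit p).
  rewrite laE mxE [RHS](reindex (enum_rank : D -> _)) //=.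
  exact/onW_bij/enum_rank_bij.
exists D, mon, (fun x => la 0 (enum_rank x)); split=> [i|j].
  have := laP (inl i); rewrite /= row_mxEl mxE eqxx /= => <-.
  by apply: eq_bigr => x _; rewrite row_mxEl mxE /mx enum_rankK.
have := laP (inr j); rewrite /= row_mxEr mxE => H; rewrite -[RHS]H.
by apply: eq_bigr => x _; rewrite row_mxEr mxE /mx enum_rankK.
Qed.

End SeparatingFunctional.

Definition lvars (F : fieldType) (n M : nat) : n.-tuple {mpoly F[n + M]} :=
  [tuple 'X_(lshift M i) | i < n].
Definition rvars (F : fieldType) (n M : nat) : M.-tuple {mpoly F[n + M]} :=
  [tuple 'X_(rshift n i) | i < M].
Arguments lvars {F n M}.
Arguments rvars {F n M}.

(* The kernel of F[x] (x) F[x'] -> F[x]/I1 (x) F[x']/I2. *)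
Definition sum_ideal (F : fieldType) (n M : nat) (I1 : {mpoly F[n]} -> Prop)
    (I2 : {mpoly F[M]} -> Prop) : {mpoly F[n + M]} -> Prop :=
  ideal_gen (fun q => (exists a, I1 a /\ q = a \mPo lvars) \/
                      (exists b, I2 b /\ q = b \mPo rvars)).

Section Tensor.

Variables (F : fieldType) (n M : nat).
Implicit Types (a : {mpoly F[n]}) (b : {mpoly F[M]}).

Definition mcat (m : 'X_{1..n}) (m' : 'X_{1..M}) : 'X_{1..n + M} :=
  [multinom match split i with inl j => m j | inr j => m' j end | i < n + M].

Definition tens a b : {mpoly F[n + M]} := (a \mPo lvars) * (b \mPo rvars).

Lemma mcat_l m m' i : mcat m m' (lshift M i) = m i.
Proof. by rewrite mnmE (unsplitK (inl i : 'I_n + 'I_M)). Qed.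

Lemma mcat_r m m' i : mcat m m' (rshift n i) = m' i.
Proof. by rewrite mnmE (unsplitK (inr i : 'I_n + 'I_M)). Qed.

Lemma tensX m m' : tens 'X_[m] 'X_[m'] = 'X_[mcat m m'].
Proof.
rewrite /tens !comp_mpolyX [RHS]mpolyXE_id big_split_ord /=.
congr (_ * _); apply: eq_bigr => i _; rewrite tnth_mktuple.
  by rewrite mcat_l.
by rewrite mcat_r.
Qed.

Lemma mcat_eq m1 m2 m1' m2' :
  (mcat m1 m1' == mcat m2 m2') = (m1 == m2) && (m1' == m2').
Proof.
apply/eqP/andP => [E|[/eqP -> /eqP -> //]].
split; apply/eqP/mnmP => i.
  by rewrite -(mcat_l m1 m1') E mcat_l.
by rewrite -(mcat_r m1 m1') E mcat_r.
Qed.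

Lemma tensE a b : tens a b =
  \sum_(m <- msupp a) \sum_(m' <- msupp b) (a@_m * b@_m') *: 'X_[mcat m m'].
Proof.
rewrite {1}[a]mpolyE {1}[b]mpolyE /tens !raddf_sum /= mulr_suml.
apply: eq_bigr => m _; rewrite mulr_sumr; apply: eq_bigr => m' _.
by rewrite !comp_mpolyZ -scalerAl -scalerAr scalerA -tensX.
Qed.

Lemma mcoeff_tens a b m m' : (tens a b)@_(mcat m m') = a@_m * b@_m'.
Proof.
rewrite tensE raddf_sum /=.
under eq_bigr => m1 _.
  rewrite raddf_sum /=.
  under eq_bigr => m2 _ do rewrite mcoeffZ mcoeffX mcat_eq.
  over.
have [am|/memN_msupp_eq0 am] := boolP (m \in msupp a); last first.
  rewrite am mul0r big1_seq // => m1 /andP[_ m1a]; rewrite big1 // => m2 _.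
  case: eqP => [E|_]; last by rewrite mulr0.
  by move: m1a; rewrite E mcoeff_msupp am eqxx.
rewrite (bigD1_seq m) ?msupp_uniq //= [X in _ + X]big1 ?addr0; last first.
  by move=> m1 /negbTE ne; rewrite big1 // => m2 _; rewrite ne mulr0.
have [bm|/memN_msupp_eq0 bm] := boolP (m' \in msupp b); last first.
  rewrite bm mulr0 big1_seq // => m2 /andP[_ m2b]; rewrite eqxx /=.
  case: eqP => [E|_]; last by rewrite mulr0.
  by move: m2b; rewrite E mcoeff_msupp bm eqxx.
rewrite (bigD1_seq m') ?msupp_uniq //= [X in _ + X]big1 ?addr0; last first.
  by move=> m2 /negbTE ne; rewrite ne andbF mulr0.
by rewrite !eqxx mulr1.
Qed.

Lemma tens_decomp (q : {mpoly F[n + M]}) :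
  exists s : seq ({mpoly F[n]} * {mpoly F[M]}), q = \sum_(x <- s) tens x.1 x.2.
Proof.
exists [seq (q@_m *: 'X_[[multinom m (lshift M i) | i < n]],
             'X_[[multinom m (rshift n i) | i < M]]) | m <- msupp q].
rewrite big_map {1}[q]mpolyE; apply: eq_bigr => m _ /=.
rewrite /tens comp_mpolyZ -scalerAl -/(tens _ _) tensX; congr (_ *: 'X_[_]).
apply/mnmP => i; case: (splitP i) => j ij.
  by rewrite (_ : i = lshift M j) ?mcat_l ?mnmE //; apply: val_inj.
by rewrite (_ : i = rshift n j) ?mcat_r ?mnmE //; apply: val_inj.
Qed.

Lemma tensDl a a' b : tens (a + a') b = tens a b + tens a' b.
Proof. by rewrite /tens comp_mpolyD mulrDl. Qed.

Lemma tensBr a b b' : tens a (b - b') = tens a b - tens a b'.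
Proof. by rewrite /tens comp_mpolyB mulrBr. Qed.

Lemma tensZl c a b : tens (c *: a) b = c *: tens a b.
Proof. by rewrite /tens comp_mpolyZ -scalerAl. Qed.

Lemma tensZr c a b : tens a (c *: b) = c *: tens a b.
Proof. by rewrite /tens comp_mpolyZ -scalerAr. Qed.

Lemma tens_suml (T : Type) (s : seq T) (h : T -> {mpoly F[n]}) b :
  tens (\sum_(x <- s) h x) b = \sum_(x <- s) tens (h x) b.
Proof. by rewrite /tens raddf_sum mulr_suml. Qed.

Lemma tensM a b a' b' : tens a b * tens a' b' = tens (a * a') (b * b').
Proof. by rewrite /tens !rmorphM mulrACA. Qed.

Variables (I1 : {mpoly F[n]} -> Prop) (I2 : {mpoly F[M]} -> Prop).
Hypotheses (iI1 : is_ideal I1) (iI2 : is_ideal I2).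

Lemma sum_ideal_tens a b : I1 a \/ I2 b -> sum_ideal I1 I2 (tens a b).
Proof.
have iS := ideal_gen_ideal (fun q : {mpoly F[n + M]} =>
  (exists a, I1 a /\ q = a \mPo lvars) \/ (exists b, I2 b /\ q = b \mPo rvars)).
case=> [Ia|Ib]; rewrite /tens.
  by apply: idealMr => //; apply: ideal_gen_mem; left; exists a.
by case: iS => _ _; apply; apply: ideal_gen_mem; right; exists b.
Qed.

(** Each generator is a pure tensor with one factor [1], and multiplying by pure tensors keeps the
    other factor in its ideal. *)
Lemma sum_idealE P : sum_ideal I1 I2 P ->
  exists s : seq ({mpoly F[n]} * {mpoly F[M]}),
    (forall x, x \in s -> I1 x.1 \/ I2 x.2) /\ P = \sum_(x <- s) tens x.1 x.2.
Proof.
case=> t [Ht ->] {P}; elim: t Ht => [|[h g] t IH] Ht.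
  by exists [::]; rewrite !big_nil.
have [|s [Hs Es]] := IH; first by move=> x xt; apply: Ht; rewrite inE xt orbT.
have [r Er] := tens_decomp h.
have Hg : exists ab : {mpoly F[n]} * {mpoly F[M]},
    (I1 ab.1 \/ I2 ab.2) /\ g = tens ab.1 ab.2.
  case: (Ht (h, g) (mem_head _ _)) => /= -[ab [Iab ->]].
    by exists (ab, 1); rewrite /tens comp_mpoly1 mulr1; split; [left|].
  by exists (1, ab); rewrite /tens comp_mpoly1 mul1r; split; [right|].
have [[a b] /= [Iab Eg]] := Hg.
exists ([seq (x.1 * a, x.2 * b) | x <- r] ++ s); split.
  move=> x; rewrite mem_cat => /orP[/mapP[y _ ->] /=|/Hs //].
  case: iI1 => _ _ M1; case: iI2 => _ _ M2.
  by case: Iab; [left; apply: M1|right; apply: M2].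
rewrite big_cons big_cat big_map /= -Es Er Eg mulr_suml; congr (_ + _).
by apply: eq_bigr => x _; rewrite tensM.
Qed.

(* Elements of A/I1 (x) B/I2 are determined by the contractions against
   functionals on A/I1. *)
Lemma sum_ideal_indep N (A : 'I_N -> {mpoly F[n]}) (B : 'I_N -> {mpoly F[M]}) :
  (forall c : 'I_N -> F, I1 (\sum_i c i *: A i) -> forall i, c i = 0) ->
  sum_ideal I1 I2 (\sum_i tens (A i) (B i)) -> forall i, I2 (B i).
Proof.
move=> indep /sum_idealE[s [Hs Es]] i0.
pose T := size s; pose S (j : 'I_T) := nth (0, 0) s j.
(* The functional is only asked to kill the first factors lying in [I1]; the other slots hold
   [0]. *)
pose u (j : 'I_T) := if excluded_middle_informative (I1 (S j).1) then (S j).1 else 0.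
have Iu j : I1 (u j).
  by rewrite /u; case: (excluded_middle_informative _) => //= ?; case: iI1.
have [|D [mon [la [laA lau]]]] := @separating_functional F n N T A u i0.
  move=> c e /eqP; rewrite addr_eq0 => /eqP E; apply: (indep c); rewrite E.
  by apply: idealN => //; apply: ideal_sum => // j _ _; apply: idealZ.
have coefE x : \sum_i (A i)@_(mon x) *: B i = \sum_(j < T) (S j).1@_(mon x) *: (S j).2.
  apply/mpolyP => m'; have := congr1 (mcoeff (mcat (mon x) m')) Es.
  rewrite !raddf_sum /= => H.
  under eq_bigr do rewrite mcoeffZ -mcoeff_tens.
  by rewrite H (big_nth (0, 0)) big_mkord; apply: eq_bigr => j _; rewrite mcoeffZ mcoeff_tens.
have -> : B i0 = \sum_x la x *: \sum_i (A i)@_(mon x) *: B i.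
  under eq_bigr do rewrite scaler_sumr.
  rewrite exchange_big /= (bigD1 i0) //= [X in _ + X]big1 ?addr0 => [|i /negbTE ne].
    under eq_bigr do rewrite scalerA.
    by rewrite -scaler_suml laA eqxx scale1r.
  under eq_bigr do rewrite scalerA.
  by rewrite -scaler_suml laA ne scale0r.
under eq_bigr do rewrite coefE scaler_sumr.
rewrite exchange_big /=; apply: ideal_sum => // j _ _.
under eq_bigr do rewrite scalerA.
rewrite -scaler_suml.
(* A term whose first factor lies in [I1] is killed by the functional; any other has its second
   factor in [I2]. *)
have [I1j|nI1j] := excluded_middle_informative (I1 (S j).1).
  have := lau j; rewrite /u; case: (excluded_middle_informative _) => //= ? ->.
  by rewrite scale0r; case: iI2.
apply: idealZ => //; have Sj : S j \in s by apply: mem_nth.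
by case: (Hs _ Sj).
Qed.

End Tensor.

Section TensorInjective.

Variables (F : fieldType) (n M a b : nat).
Variables (I1 : {mpoly F[n]} -> Prop) (I2 : {mpoly F[M]} -> Prop).
Hypotheses (iI1 : is_ideal I1) (iI2 : is_ideal I2).
Variables (f : a.-tuple {mpoly F[n]}) (g : b.-tuple {mpoly F[M]}).

Local Notation K1 := (fun p : {mpoly F[a]} => I1 (p \mPo f)).
Local Notation K2 := (fun p : {mpoly F[b]} => I2 (p \mPo g)).

Definition tens_subst : (a + b).-tuple {mpoly F[n + M]} :=
  [tuple match split i with
         | inl j => tnth f j \mPo lvars
         | inr j => tnth g j \mPo rvars end | i < a + b].

Lemma lvars_tens_subst p : (p \mPo lvars) \mPo tens_subst = (p \mPo f) \mPo lvars.
Proof.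
rewrite !comp_mpolyA; apply: eq_comp_mpoly => i; rewrite !tnth_mktuple.
by rewrite comp_mpolyXU -tnth_nth tnth_mktuple (unsplitK (inl i : 'I_a + 'I_b)).
Qed.

Lemma rvars_tens_subst p : (p \mPo rvars) \mPo tens_subst = (p \mPo g) \mPo rvars.
Proof.
rewrite !comp_mpolyA; apply: eq_comp_mpoly => i; rewrite !tnth_mktuple.
by rewrite comp_mpolyXU -tnth_nth tnth_mktuple (unsplitK (inr i : 'I_a + 'I_b)).
Qed.

Lemma tens_comp p q : tens p q \mPo tens_subst = tens (p \mPo f) (q \mPo g).
Proof. by rewrite /tens rmorphM /= lvars_tens_subst rvars_tens_subst. Qed.

Lemma sum_ideal_subst q : sum_ideal K1 K2 q -> sum_ideal I1 I2 (q \mPo tens_subst).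
Proof.
apply: (ideal_gen_sub (J := fun q => sum_ideal I1 I2 (q \mPo tens_subst))).
  exact/ideal_comp/ideal_gen_ideal.
move=> _ [[p [Kp ->]]|[p [Kp ->]]]; apply: ideal_gen_mem.
  by left; exists (p \mPo f); rewrite lvars_tens_subst.
by right; exists (p \mPo g); rewrite rvars_tens_subst.
Qed.

(* Injectivity of F[y]/K1 (x) F[z]/K2 -> F[x]/I1 (x) F[x']/I2. *)
Lemma sum_ideal_inj q : sum_ideal I1 I2 (q \mPo tens_subst) -> sum_ideal K1 K2 q.
Proof.
have iK1 : is_ideal K1 := ideal_comp f iI1.
have iK2 : is_ideal K2 := ideal_comp g iI2.
have iK : is_ideal (sum_ideal K1 K2) by apply: ideal_gen_ideal.
have iI : is_ideal (sum_ideal I1 I2) by apply: ideal_gen_ideal.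
have [s Es] := tens_decomp q.
have {s Es}[N [A [B ->]]] : exists N (A : 'I_N -> {mpoly F[a]}) (B : 'I_N -> {mpoly F[b]}),
    q = \sum_i tens (A i) (B i).
  exists (size s), (fun i => (nth (0, 0) s i).1), (fun i => (nth (0, 0) s i).2).
  by rewrite Es (big_nth (0, 0)) big_mkord.
(* Induction on the number of pure tensors: if the [A i] are independent modulo [K1], every [B i] is
   in [K2]; otherwise a relation removes one summand. *)
elim: N A B => [|N IH] A B Hq; first by rewrite big_ord0; case: iK.
have [indep|dep] := classic
  (forall c : 'I_N.+1 -> F, K1 (\sum_i c i *: A i) -> forall i, c i = 0).
  have HB : forall i, I2 (B i \mPo g).
    apply: (@sum_ideal_indep F n M I1 I2 iI1 iI2 N.+1 (fun i => A i \mPo f)).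
      move=> c Hc; apply: indep; rewrite raddf_sum.
      by under eq_bigr do rewrite /= comp_mpolyZ.
    move: Hq; rewrite raddf_sum /=.
    by under eq_bigr do rewrite tens_comp.
  by apply: ideal_sum => // i _ _; apply: sum_ideal_tens => //; right; apply: HB.
have [c [Kc [i0 ci0]]] : exists c : 'I_N.+1 -> F,
    K1 (\sum_i c i *: A i) /\ exists i, c i <> 0.
  apply: NNPP => H; apply: dep => c Kc i; apply: NNPP => ci.
  by apply: H; exists c; split=> //; exists i.
move/eqP in ci0.
(* The relation is solved for [A i0], and [B i0] is distributed over the remaining second
   factors. *)
pose A' j := A (lift i0 j).
pose B' j := B (lift i0 j) - (c (lift i0 j) / c i0) *: B i0.
have E : \sum_i tens (A i) (B i) =
    tens ((c i0)^-1 *: \sum_i c i *: A i) (B i0) + \sum_j tens (A' j) (B' j).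
  rewrite (bigD1_ord i0) //= [in RHS](bigD1_ord i0) //= scalerDr scalerA mulVf // scale1r.
  rewrite tensDl -addrA; congr (_ + _).
  rewrite scaler_sumr tens_suml -big_split /=; apply: eq_bigr => j _.
  by rewrite /A' /B' tensBr tensZr scalerA tensZl mulrC addrC subrK.
have K0 : sum_ideal K1 K2 (tens ((c i0)^-1 *: \sum_i c i *: A i) (B i0)).
  by apply: sum_ideal_tens => //; left; apply: (idealZ _ iK1 Kc).
move: Hq; rewrite E => Hq; case: (iK) => _ KD _; apply: (KD _ _ K0); apply: IH.
have := idealB iI Hq (sum_ideal_subst K0).
by rewrite comp_mpolyD addrC addKr.
Qed.

End TensorInjective.

(** * Ryser's formula and homogeneous components *)

Section Ryser.

Variables (R : comNzRingType) (k : nat).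
Implicit Type S : {set 'I_k}.

(** If [x] is not in [A], toggling the membership of [x] pairs supersets of opposite sign. *)
Lemma signed_supersets (A : {set 'I_k}) :
  \sum_(S : {set 'I_k} | A \subset S) (-1) ^+ #|~: S| = (A == setT)%:R :> R.
Proof.
have [->|AT] := eqVneq A setT.
  rewrite (big_pred1 setT) ?setCT ?cards0 // => S /=.
  by rewrite subTset.
have [x xA] : exists x, x \notin A.
  apply/existsP; rewrite -negb_forall; apply: contra AT => /forallP H.
  by apply/eqP/setP => x; rewrite inE H.
rewrite (bigID (fun S : {set 'I_k} => x \in S)) /=.
rewrite (reindex_onto (fun S => x |: S) (fun S => S :\ x)) /=; last first.
  by move=> S /andP[_ xS]; rewrite setD1K.
rewrite -[X in X + _]opprK -sumrN addrC; apply/eqP; rewrite subr_eq0; apply/eqP.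
apply: eq_big => S.
  rewrite setU11 andbT; apply/andP/andP => [[AS xS]|[AS /eqP ES]].
    by rewrite setU1K // (subset_trans AS) ?subsetUr.
  have xS : x \notin S by rewrite -ES !inE eqxx.
  split=> //; apply/subsetP => y yA; have := subsetP AS y yA.
  by rewrite !inE; case: eqP => // E; rewrite E (negbTE xA) in yA.
move=> /andP[AS xS]; rewrite (_ : ~: S = x |: ~: (x |: S)).
  by rewrite cardsU1 !inE eqxx /= exprS mulN1r.
by apply/setP => y; rewrite !inE; case: eqP => //= ->; rewrite (negbTE xS).
Qed.

(** Inclusion-exclusion: the expanded product runs over maps [g] into [S], and [signed_supersets]
    keeps the surjective ones. *)
Lemma ryser_surj m (a : 'I_m -> 'I_k -> R) :
  \sum_(S : {set 'I_k}) (-1) ^+ #|~: S| * \prod_(j < m) \sum_(l in S) a j l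
  = \sum_(g : {ffun 'I_m -> 'I_k} | g @: setT == setT) \prod_(j < m) a j (g j).
Proof.
under eq_bigr => S _ do rewrite bigA_distr_big mulr_sumr.
rewrite (exchange_big_dep predT) //= [RHS]big_mkcond /=; apply: eq_bigr => g _.
rewrite -mulr_suml.
rewrite (eq_bigl (fun S => g @: setT \subset S)) ?signed_supersets.
  by case: eqP; rewrite ?mul1r ?mul0r.
move=> S; apply/ffun_onP/subsetP => [H _ /imsetP[j _ ->]|H j]; first exact: H.
by apply: H; apply: imset_f.
Qed.

Lemma ryser_lt m (a : 'I_m -> 'I_k -> R) : (m < k)%N ->
  \sum_(S : {set 'I_k}) (-1) ^+ #|~: S| * \prod_(j < m) \sum_(l in S) a j l = 0.
Proof.
move=> mk; rewrite ryser_surj big1 // => g /eqP gT; exfalso.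
have := leq_imset_card g setT; rewrite gT !cardsT !card_ord.
by rewrite leqNgt mk.
Qed.

(** A surjective self-map of ['I_k] is a permutation, so a permanent remains. *)
Lemma ryser_eq (a : 'I_k -> 'I_k -> R) :
  \sum_(S : {set 'I_k}) (-1) ^+ #|~: S| * \prod_(j < k) \sum_(l in S) a j l
  = \sum_(s : 'S_k) \prod_(l < k) a (s l) l.
Proof.
rewrite ryser_surj.
rewrite (eq_bigl (fun g : {ffun 'I_k -> 'I_k} => injectiveb g)); last first.
  move=> g; apply/eqP/injectiveP => [gT|gi].
    have: #|g @: setT| == #|[set: 'I_k]| by rewrite gT.
    by move/imset_injP => gi x y; apply: gi; rewrite inE.
  by apply/eqP; rewrite eqEcard subsetT card_imset ?leqnn.
rewrite (reindex (@pval _)) /=; last first.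
  pose in_Sn := insubd (1%g : 'S_k).
  by exists in_Sn => /= g Ug; first apply: val_inj; apply: insubdK.
rewrite (eq_bigl predT); last by move=> s; apply: (valP s).
rewrite (reindex_inj invg_inj) /=; apply: eq_bigr => s _.
rewrite (reindex_inj (@perm_inj _ s)) /=; apply: eq_bigr => l _.
by rewrite pvalE permK.
Qed.

End Ryser.

Section Monomials.

Variable N : nat.
Implicit Type m : 'X_{1..N}.

(** A monomial of degree [k] becomes a product of [k] labelled factors, on which permutations can
    act. *)
Definition mnm_idx m : seq 'I_N := flatten [seq nseq (m i) i | i <- enum 'I_N].

Lemma size_mnm_idx m : size (mnm_idx m) = mdeg m.
Proof.
rewrite /mnm_idx size_flatten /shape -map_comp sumnE big_map mdegE big_enum.
by apply: eq_bigr => i _; rewrite /= size_nseq.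
Qed.

Lemma prod_mnm_idx (R : comNzRingType) (y : 'I_N -> R) m :
  \prod_(i <- mnm_idx m) y i = \prod_(i < N) y i ^+ m i.
Proof.
rewrite /mnm_idx big_flatten big_map big_enum; apply: eq_bigr => i _ /=.
by rewrite big_nseq; elim: (m i) => //= j ->; rewrite exprS.
Qed.

End Monomials.

Section HomogeneousParts.

Variables (F : fieldType) (n : nat).
Implicit Type p : {mpoly F[n]}.

Lemma mcoeff_hcomp e p m : (hcomp e p)@_m = if mdeg m == e then p@_m else 0.
Proof.
rewrite /hcomp raddf_sum /=.
under eq_bigr do rewrite mcoeffZ mcoeffX.
have [mp|/memN_msupp_eq0 mp] := boolP (m \in msupp p); last first.
  rewrite mp if_same big1_seq // => m' /andP[_ m'p].
  case: eqP => [E|_]; last by rewrite mulr0.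
  by move: m'p; rewrite E mcoeff_msupp mp eqxx.
case: ifP => me.
  rewrite big_mkcond (bigD1_seq m) ?msupp_uniq //= me eqxx mulr1 big1 ?addr0 //.
  by move=> m' /negbTE ne; case: ifP => // _; rewrite ne mulr0.
rewrite big1 // => m' m'e; case: eqP => [E|_]; last by rewrite mulr0.
by rewrite -E m'e in me.
Qed.

Lemma comp_monomial_homog d N (f : N.-tuple {mpoly F[n]}) m :
  (forall i, homog_of_deg d (tnth f i)) -> homog_of_deg (d * mdeg m) ('X_[m] \mPo f).
Proof.
move=> fh; rewrite comp_mpolyX mdegE big_distrr /=.
apply: (big_rec2 (fun (e : nat) (q : {mpoly F[n]}) => q \is e.-homog)).
  exact: dhomog1.
move=> i e q _ qh; apply: dhomogM => //.
by apply: dhomogMn; apply: fh.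
Qed.

Lemma homog_coeff d p m : homog_of_deg d p -> p@_m != 0 -> mdeg m = d.
Proof. by move=> /allP ph; rewrite -mcoeff_msupp => /ph /eqP. Qed.

(* Scaling the values f_i multiplies the degree [d * e] part of p(f) by s^e. *)
Lemma comp_scaled (I : {mpoly F[n]} -> Prop) d N (f : N.-tuple {mpoly F[n]})
    (s : F) (p : {mpoly F[N]}) :
  is_homog_ideal I -> (0 < d)%N -> (forall i, homog_of_deg d (tnth f i)) ->
  I (p \mPo f) -> I (p \mPo [tuple s *: tnth f i | i < N]).
Proof.
move=> [iI Ih] d0 fh Ip.
have -> : p \mPo [tuple s *: tnth f i | i < N]
    = \sum_(e < msize p) s ^+ e *: hcomp (d * e) (p \mPo f).
  apply/mpolyP => mu.
  have hE e : (hcomp (d * e) (p \mPo f))@_mu = \sum_(m <- msupp p)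
      if mdeg mu == (d * e)%N then p@_m * ('X_[m] \mPo f)@_mu else 0.
    rewrite mcoeff_hcomp; case: ifP => _; last by rewrite big1.
    rewrite (comp_mpolyEX p f) raddf_sum /=.
    by apply: eq_bigr => m _; rewrite mcoeffZ.
  rewrite [RHS]raddf_sum /= (comp_mpolyEX p) [LHS]raddf_sum /=.
  under [RHS]eq_bigr do rewrite mcoeffZ hE mulr_sumr.
  rewrite exchange_big /=; apply: eq_big_seq => m mp.
  have -> : 'X_[m] \mPo [tuple s *: tnth f i | i < N] = s ^+ mdeg m *: ('X_[m] \mPo f).
    rewrite !comp_mpolyX mdegE -prodrXr -scaler_prod; apply: eq_bigr => i _.
    by rewrite tnth_mktuple exprZn.
  rewrite !mcoeffZ.
  have [->|nz] := eqVneq (('X_[m] \mPo f)@_mu) 0.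
    by rewrite !mulr0 big1 // => e _; rewrite if_same mulr0.
  have dmu := homog_coeff (comp_monomial_homog m fh) nz.
  have me := msize_mdeg_lt mp.
  rewrite (bigD1 (Ordinal me)) //= dmu eqxx big1 ?addr0; first by rewrite mulrCA.
  (* Since [d] is positive, the degree [d * e] determines [e]. *)
  move=> e ne; rewrite eqn_pmul2l // ifN ?mulr0 //; apply: contra ne => /eqP E.
  by apply/eqP/val_inj.
by apply: ideal_sum => // e _ _; apply: idealZ => //; apply: Ih.
Qed.

Lemma homog_msize d p : homog_of_deg d p -> (msize p <= d.+1)%N.
Proof.
move=> /allP ph; rewrite mmeasureE; apply/bigmax_leqP_seq => m mp _.
rewrite ltnS; apply: eq_leq; exact/eqP/ph.
Qed.

Lemma homog_monosE (V : lmodType F) d p (h : 'X_{1..n} -> V) : homog_of_deg d p ->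
  \sum_(m <- msupp p) p@_m *: h m = \sum_(m <- monos n d) p@_m *: h m.
Proof.
move=> ph; rewrite [RHS](bigID (fun m => m \in msupp p)) /= [X in _ + X]big1 ?addr0; last first.
  by move=> m /memN_msupp_eq0 ->; rewrite scale0r.
rewrite -[RHS]big_filter; apply: perm_big; apply: uniq_perm => [||m].
- exact: msupp_uniq.
- exact/filter_uniq/monos_uniq.
rewrite mem_filter mem_monos; case: (boolP (m \in msupp p)) => //= mp.
exact/esym/(allP ph).
Qed.

End HomogeneousParts.

(** * Joins through universal points *)

Section UniversalPoints.

Variables (F : fieldType) (n : nat) (I : {mpoly F[n]} -> Prop).
Hypothesis iI : is_ideal I.

(* [k] stands for [k.+1] blocks of [n] variables, as in [starpow]. *)
Fixpoint udim (k : nat) : nat := if k is k'.+1 then (n + udim k')%N else n.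

Fixpoint uideal (k : nat) : {mpoly F[udim k]} -> Prop :=
  match k with
  | 0 => I
  | k'.+1 => sum_ideal I (@uideal k')
  end.

(** The universal points $x^1, \dots, x^r$ of $X$, one for each block of variables. *)
Fixpoint upts (k : nat) : seq (n.-tuple {mpoly F[udim k]}) :=
  match k with
  | 0 => [:: [tuple 'X_i | i < n]]
  | k'.+1 => lvars :: [seq [tuple tnth v i \mPo rvars | i < n] | v <- upts k']
  end.

(** A point of the scheme $X$ over the quotient by [aa]. *)
Definition is_point M (aa : {mpoly F[M]} -> Prop) (v : n.-tuple {mpoly F[M]}) :=
  forall q, I q -> aa (q \mPo v).

Lemma uideal_ideal k : is_ideal (@uideal k).
Proof. by case: k => //= k; apply: ideal_gen_ideal. Qed.

Lemma size_upts k : size (upts k) = k.+1.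
Proof. by elim: k => //= k IH; rewrite size_map IH. Qed.

Lemma upts_point k v : v \in upts k -> is_point (@uideal k) v.
Proof.
elim: k v => [|k IH] v /=.
  by rewrite inE => /eqP -> q Iq; rewrite comp_mpoly_id.
rewrite inE => /orP[/eqP -> q Iq|/mapP[v' /IH Hv' ->] q Iq].
  by apply: ideal_gen_mem; left; exists q.
apply: ideal_gen_mem; right; exists (q \mPo v'); split; first exact: Hv'.
by rewrite comp_mpolyA.
Qed.

(** A sum of Veronese images of points; the weights allow points to be repeated or omitted. *)
Definition point_sum M N (f : N.-tuple {mpoly F[n]})
    (sv : seq (F * n.-tuple {mpoly F[M]})) : N.-tuple {mpoly F[M]} :=
  [tuple \sum_(x <- sv) x.1 *: (tnth f i \mPo x.2) | i < N].

(** One point is substituted for the first tensor factor and the sum of the others for the second.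
    The weights are allowed because the Veronese cone is stable under scaling, which is the
    hypothesis on [s]. *)
Lemma starpow_point_sum M (aa : {mpoly F[M]} -> Prop) N
    (f : N.-tuple {mpoly F[n]}) k sv p :
  is_ideal aa ->
  (forall (s : F) q, I (q \mPo f) -> I (q \mPo [tuple s *: tnth f i | i < N])) ->
  size sv = k.+1 -> (forall x, x \in sv -> is_point aa x.2) ->
  starpow (veronese_ideal I f) k p -> aa (p \mPo point_sum f sv).
Proof.
move=> iaa fs; elim: k sv p => [|k IH] [|[s v] sv] p //=.
  case: sv => // _ Hsv Jp.
  have -> : p \mPo point_sum f [:: (s, v)] = (p \mPo [tuple s *: tnth f i | i < N]) \mPo v.
    rewrite comp_mpolyA; apply: eq_comp_mpoly => i.
    by rewrite !tnth_mktuple big_seq1 comp_mpolyZ.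
  by apply: (Hsv (s, v) (mem_head _ _)); apply: fs.
move=> [ssv] Hsv Jp.
pose tau : (N + N).-tuple {mpoly F[M]} :=
  [tuple match split i with
         | inl j => s *: (tnth f j \mPo v)
         | inr j => tnth (point_sum f sv) j end | i < N + N].
have taul i : tnth tau (lshift N i) = s *: (tnth f i \mPo v).
  by rewrite tnth_mktuple (unsplitK (inl i : 'I_N + 'I_N)).
have taur i : tnth tau (rshift N i) = tnth (point_sum f sv) i.
  by rewrite tnth_mktuple (unsplitK (inr i : 'I_N + 'I_N)).
have -> : p \mPo point_sum f ((s, v) :: sv) = (p \mPo comult F N) \mPo tau.
  rewrite comp_mpolyA; apply: eq_comp_mpoly => i; rewrite !tnth_mktuple.
  by rewrite comp_mpolyD !comp_mpolyXU -!tnth_nth taul taur tnth_mktuple big_cons.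
move: Jp; apply: (ideal_gen_sub (J := fun q => aa (q \mPo tau))); first exact: ideal_comp.
move=> _ [[a [Ja ->]]|[b [Jb ->]]].
  have -> : (a \mPo yvars F N) \mPo tau = (a \mPo [tuple s *: tnth f i | i < N]) \mPo v.
    rewrite !comp_mpolyA; apply: eq_comp_mpoly => i.
    by rewrite !tnth_mktuple comp_mpolyXU -tnth_nth taul comp_mpolyZ.
  by apply: (Hsv (s, v) (mem_head _ _)); apply: fs.
have -> : (b \mPo zvars F N) \mPo tau = b \mPo point_sum f sv.
  rewrite comp_mpolyA; apply: eq_comp_mpoly => i.
  by rewrite tnth_mktuple tnth_mktuple comp_mpolyXU -tnth_nth taur.
by apply: IH => // x xsv; apply: Hsv; rewrite inE xsv orbT.
Qed.

Definition usum N (f : N.-tuple {mpoly F[n]}) k : N.-tuple {mpoly F[udim k]} :=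
  point_sum f [seq (1, v) | v <- upts k].

Lemma usumE N (f : N.-tuple {mpoly F[n]}) k i :
  tnth (usum f k) i = \sum_(v <- upts k) (tnth f i \mPo v).
Proof. by rewrite tnth_mktuple big_map; apply: eq_bigr => v _; rewrite scale1r. Qed.

(** Converse for the universal points: the evaluation factors through the comultiplication, and
    [sum_ideal_inj] pulls the ideal of the points back to the one defining the join. *)
Lemma starpow_usum N (f : N.-tuple {mpoly F[n]}) k p :
  uideal (p \mPo usum f k) -> starpow (veronese_ideal I f) k p.
Proof.
elim: k p => [|k IH] p /=.
  rewrite (_ : p \mPo usum f 0 = p \mPo f) //; apply: eq_comp_mpoly => i.
  by rewrite usumE big_seq1 comp_mpoly_id.
have -> : p \mPo usum f k.+1 = (p \mPo comult F N) \mPo tens_subst f (usum f k).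
  rewrite comp_mpolyA; apply: eq_comp_mpoly => i.
  rewrite usumE /= big_cons big_map !tnth_mktuple comp_mpolyD !comp_mpolyXU -!tnth_nth.
  rewrite !tnth_mktuple (unsplitK (inl i : 'I_N + 'I_N)) (unsplitK (inr i : 'I_N + 'I_N)).
  rewrite usumE raddf_sum; congr (_ + _); apply: eq_bigr => v _.
  by rewrite /= comp_mpolyA.
move/(sum_ideal_inj iI (uideal_ideal k)).
apply: ideal_gen_sub; first exact: ideal_gen_ideal.
move=> q [[a [Ia ->]]|[b [Ib ->]]]; apply: ideal_gen_mem.
  by left; exists a.
by right; exists b; split=> //; apply: IH.
Qed.

Lemma starpow_ideal N (f : N.-tuple {mpoly F[n]}) k :
  is_ideal (starpow (veronese_ideal I f) k).
Proof.
case: k => [|k]; first exact: ideal_comp.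
exact: (ideal_comp (comult F N) (ideal_gen_ideal _)).
Qed.

End UniversalPoints.

(** * Polarization *)

Section Polarization.

Variables (F : fieldType) (n d N : nat) (f : N.-tuple {mpoly F[n]}).
Hypothesis fh : forall i, homog_of_deg d (tnth f i).
Local Notation word := (seq 'X_{1..n}).

Definition mnm_forms (m : 'X_{1..N}) : seq {mpoly F[n]} :=
  [seq tnth f i | i <- mnm_idx m].

(* [k`!] times the symmetric tensor attached to the degree [k] part of [p]. *)
Definition polar (k : nat) (p : {mpoly F[N]}) (w : word) : F :=
  \sum_(m <- msupp p | mdeg m == k) p@_m *
    \sum_(s : 'S_k) \prod_(l < k) (nth 0 (mnm_forms m) (s l))@_(nth 0%MM w l).

Lemma mnm_forms_homog m l : (l < mdeg m)%N -> homog_of_deg d (nth 0 (mnm_forms m) l).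
Proof.
move=> lm; have : nth 0 (mnm_forms m) l \in mnm_forms m.
  by rewrite mem_nth // size_map size_mnm_idx.
by case/mapP => i _ ->.
Qed.

(** Multilinearity: summing over words against a product over positions evaluates each form
    separately. *)
Lemma polar_sum M k p (h : nat -> 'X_{1..n} -> {mpoly F[M]}) :
  \sum_(w <- words n k d) polar k p w *: \prod_(l < k) h l (nth 0%MM w l)
  = \sum_(m <- msupp p | mdeg m == k) p@_m *: \sum_(s : 'S_k) \prod_(l < k)
      \sum_(mu <- msupp (nth 0 (mnm_forms m) (s l)))
        (nth 0 (mnm_forms m) (s l))@_mu *: h l mu.
Proof.
under eq_bigr do rewrite scaler_suml.
rewrite exchange_big /=; apply: eq_bigr => m /eqP mk.
under eq_bigr do rewrite -scalerA scaler_suml.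
rewrite -scaler_sumr exchange_big /=; congr (_ *: _); apply: eq_bigr => s _.
under eq_bigr do rewrite -scaler_prod.
pose g l := nth 0 (mnm_forms m) (s l).
(* [big_words] takes families indexed by natural numbers; [insub] extends this one by [0] from [k]
   on. *)
pose c l mu := if insub l is Some l' then (g l')@_mu *: h l mu else 0.
have cE (l : 'I_k) mu : c l mu = (g l)@_mu *: h l mu by rewrite /c valK.
under eq_bigr => w _ do under eq_bigr do rewrite -cE.
rewrite (big_words k d c); apply: eq_bigr => l _.
rewrite (homog_monosE (d := d)); first by apply: eq_bigr => mu _; rewrite cE.
by apply: mnm_forms_homog; rewrite mk.
Qed.

(* By Ryser's formula the polarization is a signed sum of values of p. *)
Lemma polar_eval M k p (vs : seq (n.-tuple {mpoly F[M]})) (v0 : n.-tuple {mpoly F[M]}) :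
  (msize p <= k.+1)%N -> size vs = k ->
  \sum_(w <- words n k d) polar k p w *: weval w vs
  = \sum_(S : {set 'I_k}) (-1) ^+ #|~: S| *
      (p \mPo [tuple \sum_(l in S) (tnth f i \mPo nth v0 vs l) | i < N]).
Proof.
move=> pk svs.
have wE w : w \in words n k d ->
    weval w vs = \prod_(l < k) ('X_[nth 0%MM w l] \mPo nth v0 vs l).
  rewrite mem_words => /andP[/eqP sw _]; elim: k w vs sw svs {pk} => [|k IH] [|m w] [|v vs'] //=.
    by rewrite big_ord0.
  by move=> [sw] [sv]; rewrite big_ord_recl /= -IH.
rewrite (eq_big_seq (fun w => polar k p w *:
   \prod_(l < k) ('X_[nth 0%MM w l] \mPo nth v0 vs l))); last by move=> w /wE ->.
rewrite (polar_sum k p (fun l mu => 'X_[mu] \mPo nth v0 vs l)).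
under [RHS]eq_bigr do rewrite (comp_mpolyEX p) mulr_sumr.
rewrite exchange_big /= [LHS]big_mkcond /=; apply: eq_big_seq => m mp.
have mk : (mdeg m <= k)%N by rewrite -ltnS (leq_trans (msize_mdeg_lt mp)).
under [RHS]eq_bigr do rewrite -scalerAr.
rewrite -scaler_sumr.
pose a (j : nat) (l : 'I_k) := nth 0 (mnm_forms m) j \mPo nth v0 vs l.
have XE (S : {set 'I_k}) : 'X_[m] \mPo [tuple \sum_(l in S) (tnth f i \mPo nth v0 vs l) | i < N]
    = \prod_(j < mdeg m) \sum_(l in S) a j l.
  rewrite comp_mpolyX -(prod_mnm_idx (tnth _)).
  rewrite -(size_mnm_idx m).
  (* An empty index list offers no default index for [big_nth]. *)
  have [E0|[i0 _]] : mnm_idx m = [::] \/ exists i0 : 'I_N, True.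
  - by case: (mnm_idx m) => [|i0 ?]; [left|right; exists i0].
  - by rewrite E0 big_nil big_ord0.
  rewrite (big_nth i0) big_mkord; apply: eq_bigr => j _.
  by rewrite tnth_mktuple /a /mnm_forms (nth_map i0).
under [in RHS]eq_bigr do rewrite XE.
(* A monomial of degree less than [k] cannot use all [k] points, so its signed sum is zero; in
   degree [k] it is a permanent. *)
case: eqP => [E|/eqP ne]; last first.
  by rewrite ryser_lt ?scaler0 // ltn_neqAle ne.
rewrite E; congr (_ *: _); rewrite (ryser_eq (fun j => a j)); apply: eq_bigr => s _.
by apply: eq_bigr => l _; rewrite /a (comp_mpolyEX (nth 0 _ _)).
Qed.

End Polarization.

(** * Ideals of secant schemes *)

Lemma ideal_prod_congr (F : fieldType) M (aa : {mpoly F[M]} -> Prop) (T : eqType)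
    (s : seq T) (x y : T -> {mpoly F[M]}) : is_ideal aa ->
  (forall t, t \in s -> aa (x t - y t)) -> aa (\prod_(t <- s) x t - \prod_(t <- s) y t).
Proof.
move=> iaa; case: (iaa) => a0 aD aM; elim: s => [|t s IH] H.
  by rewrite !big_nil subrr.
rewrite !big_cons.
have -> : x t * \prod_(j <- s) x j - y t * \prod_(j <- s) y j =
    x t * (\prod_(j <- s) x j - \prod_(j <- s) y j) + (x t - y t) * \prod_(j <- s) y j.
  by rewrite mulrBr mulrBl addrA subrK.
apply: aD; last by apply: idealMr => //; apply: H; rewrite mem_head.
by apply: aM; apply: IH => t' t's; apply: H; rewrite inE t's orbT.
Qed.

Section PointLists.

Variables (F : fieldType) (n M : nat) (pts : seq (n.-tuple {mpoly F[M]})).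

Fixpoint point_lists (k : nat) : seq (seq (n.-tuple {mpoly F[M]})) :=
  if k is k'.+1 then [seq v :: vs | v <- pts, vs <- point_lists k'] else [:: [::]].

Lemma mem_point_lists k vs : vs \in point_lists k -> size vs = k /\ {subset vs <= pts}.
Proof.
elim: k vs => [|k IH] vs /=; first by rewrite inE => /eqP ->.
case/allpairsP => -[v vs'] /= [vp /IH[<- sub] ->]; split=> // u.
by rewrite inE => /orP[/eqP ->|/sub].
Qed.

Lemma prod_point_sum (w : seq 'X_{1..n}) :
  \prod_(m <- w) \sum_(v <- pts) ('X_[m] \mPo v)
  = \sum_(vs <- point_lists (size w)) weval w vs.
Proof.
elim: w => [|m w IH] /=; first by rewrite big_nil big_seq1.
rewrite big_cons IH big_allpairs_dep mulr_suml; apply: eq_bigr => v _ /=.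
by rewrite mulr_sumr.
Qed.

End PointLists.

Section Secants.

Variables (F : fieldType) (n : nat) (I : {mpoly F[n]} -> Prop).
Hypotheses (hchar : [pchar F] =i pred0) (hI : is_homog_ideal I).
Variables (d N k : nat) (f : N.-tuple {mpoly F[n]}).
Hypotheses (d_gt0 : (0 < d)%N) (fB : basis_of_Bd I d f).

Local Notation aa := (@uideal F n I k).
Local Notation pts := (upts F n k).
Local Notation KK := (starpow (veronese_ideal I f) k).

Let iI : is_ideal I. Proof. by case: hI. Qed.
Let iaa : is_ideal aa. Proof. exact: uideal_ideal. Qed.
Let fh : forall i, homog_of_deg d (tnth f i). Proof. by case: fB. Qed.

(** By [polar_eval] it suffices that [p] vanishes at sums over subsets of [vs]. Collecting equal
    points turns these into sums of universal points with integer weights. *)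
Lemma vanish_polar K p : KK p -> (msize p <= K.+1)%N -> vanish aa pts K d (polar f K p).
Proof.
move=> Kp pK vs svs sub; pose v0 : n.-tuple {mpoly F[udim n k]} := [tuple 0 | i < n].
rewrite (polar_eval fh v0 pK svs); apply: ideal_sum => // S _ _.
case: iaa => _ _; apply.
(* Multiplicity of the [a]-th universal point among the entries of [vs] selected by [S], equal
   points being counted at their first index. *)
pose c (a : 'I_(size pts)) : F :=
  #|[set l in S | index (nth v0 vs l) pts == a]|%:R.
pose sv := [seq (c a, nth v0 pts a) | a : 'I_(size pts)].
rewrite (_ : p \mPo _ = p \mPo point_sum f sv); last first.
  apply: eq_comp_mpoly => i; rewrite !tnth_mktuple big_map big_enum /=.
  under [RHS]eq_bigr => a _.
    rewrite scaler_nat -sumr_const big_mkcond /=.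
    under eq_bigr do rewrite inE if_and.
    over.
  rewrite [RHS]exchange_big [LHS]big_mkcond; apply: eq_bigr => l _ /=.
  case: ifP => lS; last by rewrite big1.
  have vl : nth v0 vs l \in pts by apply/sub/mem_nth; rewrite svs.
  have il : (index (nth v0 vs l) pts < size pts)%N by rewrite index_mem.
  rewrite (bigD1 (Ordinal il)) //= eqxx nth_index // big1 ?addr0 // => a ne.
  by rewrite ifN //; apply: contra ne => /eqP E; apply/eqP/val_inj.
apply: (starpow_point_sum (I := I) (k := k)) => //.
- by move=> s q; apply: (comp_scaled (d := d)).
- by rewrite size_map size_enum_ord size_upts.
- by move=> _ /mapP[a _ ->] /=; apply: upts_point; apply: mem_nth.
Qed.

Variable c : 'X_{1..n} -> 'I_N -> F.
Hypothesis cP : forall m, mdeg m = d -> I ('X_[m] - \sum_i c m i *: tnth f i).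

(** The class of [m] in $B_d$, as a linear form in the basis given by [f]. *)
Definition lift_mono (m : 'X_{1..n}) : {mpoly F[N]} := \sum_i c m i *: 'X_i.

(** Image of the tensor [P] under $S_d^{\otimes K} \to \mathrm{Sym}^K(B_d)$. *)
Definition tensor_poly K (P : seq 'X_{1..n} -> F) : {mpoly F[N]} :=
  \sum_(w <- words n K d) P w *: \prod_(m <- w) lift_mono m.

Lemma tensor_poly_homog K P : homog_of_deg K (tensor_poly K P).
Proof.
change (tensor_poly K P \is K.-homog).
rewrite /tensor_poly big_seq; apply: rpred_sum => w.
rewrite mem_words => /andP[/eqP <- _]; apply: rpredZ.
elim: w => [|m w IH]; first by rewrite big_nil; apply: dhomog1.
rewrite big_cons -[size _]/(1 + size w)%N; apply: dhomogM => //.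
by apply: rpred_sum => i _; apply: rpredZ; rewrite dhomogX /= mdeg1.
Qed.

(** At the universal sum [lift_mono m] becomes, modulo the ideal, the sum of [m] over all points.
    The expanded product consists of evaluations at lists of points, where [P] vanishes. *)
Lemma tensor_poly_starpow K P : vanish aa pts K d P -> KK (tensor_poly K P).
Proof.
move=> vP; apply: starpow_usum => //; set g := usum f k.
rewrite /tensor_poly raddf_sum /=.
have lg m : mdeg m = d -> aa ((lift_mono m \mPo g) - \sum_(v <- pts) ('X_[m] \mPo v)).
  move=> md.
  have -> : lift_mono m \mPo g = \sum_(v <- pts) ((\sum_i c m i *: tnth f i) \mPo v).
    rewrite raddf_sum /=.
    under eq_bigr do rewrite comp_mpolyZ comp_mpolyXU -tnth_nth usumE scaler_sumr.
    rewrite exchange_big; apply: eq_bigr => v _ /=.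
    by rewrite raddf_sum; apply: eq_bigr => i _; rewrite /= comp_mpolyZ.
  rewrite -sumrB; apply: ideal_sum => // v vp _.
  rewrite -comp_mpolyB; apply: (upts_point vp); rewrite -opprB.
  by apply: idealN => //; apply: cP.
pose Y := \sum_(w <- words n K d) P w *: \prod_(m <- w) \sum_(v <- pts) ('X_[m] \mPo v).
have aY : aa Y.
  have -> : Y = \sum_(vs <- point_lists pts K) \sum_(w <- words n K d) P w *: weval w vs.
    rewrite exchange_big /=; apply: eq_big_seq => w; rewrite mem_words => /andP[/eqP sw _].
    by rewrite prod_point_sum sw scaler_sumr.
  by apply: ideal_sum => // vs /mem_point_lists[svs sub] _; apply: vP.
set Z := (X in aa X); rewrite -[Z](subrK Y).
case: (iaa) => _ aD _; apply: aD => //.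
rewrite /Z /Y -sumrB; apply: ideal_sum => // w; rewrite mem_words => /andP[_ /allP wd] _.
rewrite comp_mpolyZ -scalerBr rmorph_prod /=; apply: idealZ => //.
by apply: ideal_prod_congr => // m /wd /eqP; apply: lg.
Qed.

Lemma tensor_poly_polar K p : tensor_poly K (polar f K p) = K`!%:R *: hcomp K p.
Proof.
(* Coordinates in the basis [f] are unique modulo [I], so those of [tnth f i] are the trivial
   ones. *)
have lf i : \sum_(mu <- msupp (tnth f i)) (tnth f i)@_mu *: lift_mono mu = 'X_i.
  pose b j := \sum_(mu <- msupp (tnth f i)) (tnth f i)@_mu * c mu j.
  have E (V : lmodType F) (x : 'I_N -> V) :
      \sum_(mu <- msupp (tnth f i)) (tnth f i)@_mu *: (\sum_j c mu j *: x j)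
      = \sum_j b j *: x j.
    under eq_bigr do rewrite scaler_sumr.
    rewrite exchange_big; apply: eq_bigr => j _ /=; rewrite scaler_suml.
    by apply: eq_bigr => mu _; rewrite scalerA.
  rewrite E; case: fB => _ indep _.
  have {}indep := indep (fun j => (j == i)%:R - b j).
  have bE j : b j = (j == i)%:R.
    apply/esym/eqP; rewrite -subr_eq0; apply/eqP; apply: indep.
    under eq_bigr do rewrite scalerBl.
    rewrite sumrB (bigD1 i) //= eqxx scale1r big1 ?addr0; last first.
      by move=> l /negbTE ->; rewrite scale0r.
    rewrite -E {1}[tnth f i]mpolyE -sumrB; apply: ideal_sum => // mu mp _.
    rewrite -scalerBr; apply: idealZ => //; apply: cP.
    exact/eqP/(allP (fh i)).
  rewrite (bigD1 i) //= bE eqxx scale1r big1 ?addr0 // => j /negbTE ji.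
  by rewrite bE ji scale0r.
rewrite /tensor_poly (eq_big_seq (fun w => polar f K p w *:
   \prod_(l < K) lift_mono (nth 0%MM w l))); last first.
  move=> w; rewrite mem_words => /andP[/eqP sw _].
  by rewrite (big_nth 0%MM) big_mkord sw.
rewrite (polar_sum fh K p (fun _ => lift_mono)) /hcomp scaler_sumr.
apply: eq_bigr => m /eqP mK; rewrite scalerA mulrC -scalerA; congr (_ *: _).
rewrite (eq_bigr (fun _ => 'X_[m])); last first.
  move=> s _; have [E0|[i0 _]] : mnm_idx m = [::] \/ exists i0 : 'I_N, True.
  - by case: (mnm_idx m) => [|i0 ?]; [left|right; exists i0].
  - move: mK; rewrite -size_mnm_idx E0 /= => K0; move: (s); rewrite -K0 => s'.
    by rewrite big_ord0 mpolyXE_id -(prod_mnm_idx (fun i => 'X_i)) E0 big_nil.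
  rewrite mpolyXE_id -(prod_mnm_idx (fun i => 'X_i)) (big_nth i0) big_mkord.
  rewrite size_mnm_idx mK [RHS](reindex_inj (@perm_inj _ s)) /=.
  apply: eq_bigr => l _; rewrite /mnm_forms (nth_map i0) ?lf //.
  by rewrite size_mnm_idx mK.
by rewrite sumr_const card_Sn scaler_nat.
Qed.

Lemma secant_generated C :
  (forall K w, (C < K)%N -> lead_word aa pts K d w -> reducible aa pts d w) ->
  generated_in_deg_le KK C.
Proof.
move=> HC; pose G := ideal_gen (fun q => KK q /\ (msize q <= C.+1)%N).
have iG : is_ideal G by apply: ideal_gen_ideal.
have iK : is_ideal KK by apply: starpow_ideal.
have GK p : G p -> KK p by apply: ideal_gen_sub => // q [].
(* Tensors of length at most [C] give generators, and [vanish_short_ind] reduces the longer ones to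
   them. *)
have Gt K P : vanish aa pts K d P -> G (tensor_poly K P).
  move: K P; apply: (vanish_short_ind iaa iG HC) => K P KC vP.
  apply: ideal_gen_mem; split; first exact: tensor_poly_starpow.
  by apply: leq_trans (homog_msize (tensor_poly_homog K P)) _.
move=> p; split=> [|/GK //].
have [K] := ubnP (msize p); elim: K p => // K IH p; rewrite ltnS => pK Kp.
case: K pK IH => [|K] pK IH.
  by move: pK; rewrite leqn0 msize_poly_eq0 => /eqP ->; case: iG.
have Gtop : G (hcomp K p).
  have := Gt K _ (vanish_polar Kp pK); rewrite tensor_poly_polar => H.
  have nz : K`!%:R != 0 :> F.
    by move/pcharf0P: hchar => ->; rewrite -lt0n fact_gt0.
  by have := idealZ (K`!%:R)^-1 iG H; rewrite scalerA mulVf // scale1r.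
rewrite -[p](subrK (hcomp K p)); case: (iG) => _ GD _; apply: GD => //.
apply: IH; last by apply: idealB => //; apply: GK.
rewrite ltnS mmeasureE; apply/bigmax_leqP_seq => m.
rewrite mcoeff_msupp mcoeffB mcoeff_hcomp => mp _.
change (mdeg m < K)%N; rewrite ltn_neqAle; move: mp; case: ifP => _; first by rewrite subrr eqxx.
rewrite subr0 -mcoeff_msupp /= => /msize_mdeg_lt mp.
by rewrite -ltnS; apply: leq_trans mp pK.
Qed.

End Secants.

Theorem theorem5p1 (F : fieldType) (hchar : [pchar F] =i pred0)
  (n : nat) (I : {mpoly F[n]} -> Prop) (hI : is_homog_ideal I) :
  forall r : nat, (0 < r)%N ->
  exists C : nat, forall d : nat, (1 <= d)%N ->
    forall (m : nat) (f : m.-tuple {mpoly F[n]}),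
      basis_of_Bd I d f ->
      generated_in_deg_le (starpow (veronese_ideal I f) r.-1) C.
Proof.
move=> r _; have [iI _] := hI.
(* The universal points and their ideal depend only on [I] and [r], so [C] is fixed before [d]. The
   index [r.-1] stands for [r] points. *)
have [C HC] := lead_words_reducible (upts F n r.-1) (uideal_ideal iI r.-1).
exists C => d d1 m f fB.
have ex mu : exists c : 'I_m -> F, mdeg mu = d -> I ('X_[mu] - \sum_i c i *: tnth f i).
  have [md|nmd] := eqVneq (mdeg mu) d; last by exists (fun _ => 0) => /eqP; rewrite (negbTE nmd).
  case: fB => _ _ /(_ 'X_[mu])[|c Hc]; last by exists c.
  by rewrite /homog_of_deg msuppX /= md eqxx.
have [c cP] := choice _ ex.
by apply: (secant_generated hchar hI d1 fB cP) => K w; apply: HC.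
Qed.
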